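(* Let $n$ be a positive integer and let $f(z_1,\dots,z_n)=\sum_{j_1\geq 0,\dots,j_n\geq 0}a_{j_1\dots j_n}z_1^{j_1}\cdots z_n^{j_n}$ be a power series with $a_{j_1\dots j_n}\in\mathbb{Z}$ for all $j_1,\dots,j_n\ge 0$. Let $\Omega\subset\mathbb{C}^n$ be the convergence domain of $f$, and assume that the $n$-torus $T^n=\{(z_1,\dots,z_n)\in\mathbb{C}^n : |z_j|=1,\ j=1,\dots,n\}$ lies on the boundary of $\Omega$. Then $f$ represents a rational function if and only if there exist positive integers $m_1,\dots,m_{n-1}$ such that for every $(\theta_1,\dots,\theta_{n-1})\in\mathbb{R}^{n-1}$ there exist a point $z_0\in\mathbb{C}$ with $|z_0|=1$, an open set $U\subset\mathbb{C}^n$ containing the point $(z_0,e^{i\theta_1}z_0^{m_1},\dots,e^{i\theta_{n-1}}z_0^{m_{n-1}})$, and a holomorphic function $F$ on $U$ such that $F=f$ on $\Omega\cap U$.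
   Context: The convergence domain $\Omega$ of a power series in $n$ complex variables centered at the origin is the interior of the set of points of $\mathbb{C}^n$ at which the series converges absolutely; it is a complete Reinhardt domain, and $f$ is holomorphic on it. ''$f$ represents a rational function'' means that there are polynomials $P,Q$ in $z_1,\dots,z_n$, with $Q$ not identically zero, such that $f=P/Q$ (equivalently $Qf=P$ as power series). When $n=1$ the lists $m_1,\dots,m_{n-1}$ and $\theta_1,\dots,\theta_{n-1}$ are empty. *)

(* Defs.v *)
From HB Require Import structures.
From mathcomp Require Import all_boot all_order all_algebra.
From mathcomp Require Import all_classical all_reals all_analysis.
From mathcomp Require Import complex.
(* The notations of mpoly clash with those of mathcomp-analysis. *)
From mathcomp Require Import -(notations) mpoly.
From mathcomp.analysis.showcase Require summability.

Set Implicit Arguments.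
Unset Strict Implicit.
Unset Printing Implicit Defensive.

Import Order.TTheory GRing.Theory Num.Theory.
Import numFieldNormedType.Exports.

Local Open Scope classical_set_scope.
Local Open Scope complex_scope.
Local Open Scope ring_scope.

(* mathcomp-analysis puts the topology of a numFieldType K on K^o only; this
   gives R[i] itself its usual topology, as a normed module over itself. *)
HB.instance Definition _ (R : rcfType) := NormedModule.copy R[i] R[i]^o.

(* Formal power series in n variables with integer coefficients, as the family
   of their coefficients. *)
Definition powser (n : nat) := multinom n -> int.

Section PowerSeries.
Variables (R : realType) (n : nat).
Implicit Types (a : powser n) (z : 'rV[R[i]]_n) (A U : set 'rV[R[i]]_n).

Definition psterm a z (k : multinom n) : R[i] :=
  (a k)%:~R * \prod_(j < n) z 0 j ^+ k j.

(* normc w : R is the modulus of w, whereas `|w| lives in R[i]. *)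
Definition abs_convergent a z : Prop :=
  esum.summable [set: multinom n] (fun k => (Normc.normc (psterm a z k))%:E).

Definition convergence_domain a : set 'rV[R[i]]_n :=
  interior [set z | abs_convergent a z].

(* The unordered sum: the limit of the partial sums over the finite sets of
   multi-indices, directed by inclusion (junk value without convergence). *)
Definition pssum a z : R[i] := summability.sum (psterm a z).

(* There are polynomials P and Q over the complex numbers, with Q nonzero, such
   that Q * f = P as formal power series: the left-hand side is the coefficient
   of the Cauchy product Q * f at k. *)
Definition represents_rational a : Prop :=
  exists P Q : mpoly n R[i], Q != 0 /\
    forall k : multinom n,
      \sum_(d <- msupp Q | [forall j, d j <= k j]%N)
        mcoeff d Q * (a (mnm_sub k d))%:~R = mcoeff k P.

Definition torus : set 'rV[R[i]]_n := [set z | forall j, `|z 0 j| = 1].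

Definition boundary A : set 'rV[R[i]]_n := closure A `\` interior A.

(* The scalars of both normed modules are R[i], so that [differentiable] asks
   for a complex-linear differential. *)
Definition holomorphic_on U (F : 'rV[R[i]]_n -> R[i]) : Prop :=
  forall z, U z -> differentiable F z.

End PowerSeries.

(* exp (i t) *)
Definition expi (R : realType) (t : R) : R[i] := cos t +i* sin t.

(* The point (w, exp (i theta_0) w ^ m_0, ..., exp (i theta_(n-1)) w ^ m_(n-1)):
   [unlift ord0 j] is None at j = 0 and Some k at j = k + 1. *)
Definition curve_point (R : realType) (n : nat) (m : 'I_n -> nat)
    (theta : 'I_n -> R) (w : R[i]) : 'rV[R[i]]_n.+1 :=
  \row_j (if unlift ord0 j is Some k then expi (theta k) * w ^+ m k else w).

(* Main.v *)
Require Import Defs.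
From HB Require Import structures.
From mathcomp Require Import all_boot all_order all_fingroup all_algebra.
From mathcomp Require Import all_classical all_reals all_analysis.
From mathcomp Require Import complex finmap zify ring lra.
From mathcomp Require Import -(notations) mpoly.
From mathcomp.analysis.showcase Require summability.

Set Implicit Arguments.
Unset Strict Implicit.
Unset Printing Implicit Defensive.

Import Order.TTheory GRing.Theory Num.Theory.
Import numFieldNormedType.Exports.

Local Open Scope classical_set_scope.
Local Open Scope ring_scope.

(* If f is rational, a substitution z_(i+1) = t_i w^(B^i) with B large keeps the
   monomials of the denominator Q apart (Kronecker), so that Q does not vanish
   at some point w of the unit circle, where P/Q extends f.

   Conversely, put g_t(w) = f(w, t_1 w^(m_1), ..., t_n w^(m_n)) with |t_i| = 1.
   The coefficients A_k(t) of g_t are integer polynomials in t, and the Hankel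
   determinants D_N(t) = det (A_(i+j)(t))_(i,j<N) tend to 0 for each t: with a
   unitriangular change of basis, D_N becomes the determinant of the integrals
   of g_t(z) p_i(1/z) p_j(1/z) dz/z over a contour which bulges out of the unit
   disc near z0, where g_t extends, and lies slightly inside elsewhere; p_i is
   essentially a power of one fixed monic polynomial p, and p(1/z) has modulus
   at most rho < 1 on this contour.  The bounds are locally uniform in t, so by
   compactness |D_N| < 1 on the whole torus for all large N.  Each coefficient
   of D_N is an integer, and an average over the torus of D_N times a character,
   hence D_N = 0.
   Kronecker's criterion over Z[t] then yields a linear recurrence for the A_k,
   from which a denominator of f is read off.

   Integrals are replaced by trapezoidal sums over dyadic subdivisions; these
   are exact for affine functions, which is all that Goursat's bisection
   argument for deforming the contour requires. *)

(** * Kronecker's criterion *)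

(** The unit circle has capacity exactly 1, so every monic polynomial has modulus at least 1
    somewhere on it. The bulge of the contour dents the set of inverses 1/z, and the dent brings the
    capacity below 1; [arc_poly] is an explicit monic polynomial that witnesses this. A basis
    polynomial of degree i is then of order rho^(i/k), with k the degree of p, and D_N is at most
    about N! c^N rho^(N^2/k): the quadratic exponent beats the factorial and any bound c on the
    entries, however large. The obstacle is the rest of the circle. There the series is only
    controlled strictly inside the disc, where |1/z| exceeds 1, which works against p. Hence the
    order of the choices: the radius e of the disc where the extension lives fixes the width u of
    the bulge, then u fixes the degree k, then the weight eta, and only then the distance d to the
    unit circle, so small that its effect on p is negligible. None of them depends on t or on the
    bound of g_t. *)

Section Hankel.
Variables (D : idomainType) (a : nat -> D).

Definition hankel N : 'M[D]_N := \matrix_(i, j) a (i + j).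

(** The empty determinant is 1, so the descent from [N1] must meet a nonsingular matrix. *)
Lemma last_nonsingular_hankel N1 :
  (forall N, (N1 <= N)%N -> \det (hankel N) = 0) ->
  exists N0, \det (hankel N0) != 0 /\
    forall N, (N0 < N)%N -> \det (hankel N) = 0.
Proof.
elim: N1 => [/(_ 0%N isT)|N1 IH h].
  by rewrite det_mx00 => /eqP; rewrite oner_eq0.
case: (eqVneq (\det (hankel N1)) 0) => [e|ne].
  apply: IH => N; rewrite leq_eqVlt => /orP[/eqP <- //|]; exact: h.
by exists N1; split => // N; exact: h.
Qed.

Lemma hankel_recurrence N0 (q : nat -> D) :
    \det (hankel N0) != 0 -> q N0 != 0 ->
    (forall N, (N0 < N)%N -> \det (hankel N) = 0) ->
    (forall i, (i <= N0)%N -> \sum_(j < N0.+1) q j * a (i + j) = 0) ->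
  forall i, \sum_(j < N0.+1) q j * a (i + j) = 0.
Proof.
move=> dN0 qN0 hdet hL; pose L i := \sum_(j < N0.+1) q j * a (i + j).
suff {hL} step m : (N0 < m)%N -> (forall i, (i < m)%N -> L i = 0) -> L m = 0.
  move=> i; rewrite -/(L i); elim/ltn_ind: i => i IH.
  case: (leqP i N0) => [|lt]; [exact: hL|exact: step].
move=> N0m IH; have [s es] : exists s, (m = N0 + s.+1)%N.
  by exists (m - N0).-1; lia.
(* The columns of hankel _ *m T from N0 on are values of L, which vanish before
   m: the product is block triangular, with diagonal blocks hankel N0 and an
   antitriangular matrix whose antidiagonal entries are all L m. *)
pose T : 'M[D]_(N0 + s.+2) := \matrix_(k, j)
  (if (j < N0)%N then (k == j)%:R
   else if (j - N0 <= k <= j)%N then q (k - (j - N0))%N else 0).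
pose M : 'M[D]_(N0 + s.+2) := \matrix_(i, j)
  (if (j < N0)%N then a (i + j)%N else L (i + j - N0)%N).
have HT : hankel _ *m T = M.
  apply/matrixP => i j; rewrite !mxE; case: ifP => jN.
    rewrite (bigD1 j) //= !mxE jN eqxx mulr1 big1 ?addr0 // => k /negPf kj.
    by rewrite !mxE jN kj mulr0.
  have jN0 : (N0 <= j)%N by rewrite leqNgt jN.
  rewrite /L (eq_bigr (fun k : 'I__ => if (j - N0 <= k < (j - N0) + N0.+1)%N
     then q (k - (j - N0))%N * a (i + k)%N else 0)); last first.
    move=> k _; rewrite !mxE jN mulrC.
    have -> : ((j - N0) + N0.+1 = j.+1)%N by lia.
    by rewrite ltnS; case: ifP => _ //; rewrite mul0r.
  rewrite -big_mkcond /=.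
  rewrite -(big_mkord (fun k => (j - N0 <= k < j - N0 + N0.+1)%N)
    (fun k => q (k - (j - N0))%N * a (i + k)%N)).
  rewrite (@big_cat_nat _ _ _ (j - N0)) ?leq0n //=; last by have := ltn_ord j; lia.
  rewrite big_nat_cond big1 ?add0r; last by move=> k; lia.
  rewrite (@big_cat_nat _ _ _ (j - N0 + N0.+1)) /=; [|lia|have := ltn_ord j; lia].
  rewrite [X in _ + X]big_nat_cond [X in _ + X]big1 ?addr0; last by move=> k; lia.
  rewrite (eq_bigl (fun k => (j - N0 <= k < j - N0 + N0.+1)%N && true));
    last by move=> k; rewrite andbT.
  rewrite -big_nat_cond -{1}[(j - N0)%N]add0n big_addn.
  have -> : (j - N0 + N0.+1 - (j - N0) = N0.+1)%N by lia.
  rewrite big_mkord; apply: eq_bigr => k _.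
  by congr (q _ * a _); lia.
have dT : \det T = q N0 ^+ s.+2.
  rewrite -det_tr det_trig; last first.
    apply/is_trig_mxP => i j ij; rewrite !mxE.
    case: ifP => iN; first by rewrite -val_eqE gtn_eqF.
    have -> : (j <= i)%N = false by apply/negbTE; rewrite -ltnNge.
    by rewrite andbF.
  rewrite big_split_ord /= big1 ?mul1r => [|i _]; last first.
    by rewrite !mxE /= ltn_ord eqxx.
  rewrite -[s.+2 in RHS]card_ord -prodr_const; apply: eq_bigr => i _.
  rewrite !mxE /= ltnNge leq_addr /= leqnn andbT.
  have -> : (N0 + i - N0 <= N0 + i)%N by lia.
  by congr q; lia.
have dM : \det M = 0 by rewrite -HT det_mulmx hdet ?mul0r //; lia.
pose B : 'M[D]_s.+2 := \matrix_(i, j) L (N0 + i + j)%N.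
pose K : 'M[D]_(s.+2, N0) := \matrix_(i, j) a (N0 + i + j)%N.
have eM : M = block_mx (hankel N0) 0 K B.
  apply/matrixP => i j; rewrite -(splitK i) -(splitK j).
  case: (fintype.split i) => i'; case: (fintype.split j) => j' /=.
  - by rewrite block_mxEul !mxE /= ltn_ord.
  - rewrite block_mxEur !mxE /= ltnNge leq_addr /= IH //.
    by have := ltn_ord i'; have := ltn_ord j'; lia.
  - by rewrite block_mxEdl !mxE /= ltn_ord.
  - rewrite block_mxEdr !mxE /= ltnNge leq_addr /=; congr L; lia.
have dB : \det B = 0.
  move: dM; rewrite eM det_lblock => /eqP; rewrite mulf_eq0 (negPf dN0).
  by move=> /eqP.
(* Reversing the columns makes [B] triangular; the sign of the permutation is harmless, since the
   determinant is already known to vanish. *)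
pose w : 'S_s.+2 := perm (@rev_ord_inj s.+2).
have dB' : \det (col_perm w B) = 0 by rewrite col_permE det_mulmx dB mul0r.
have : \det (col_perm w B) = L m ^+ s.+2.
  rewrite det_trig; last first.
    apply/is_trig_mxP => i j ij; rewrite !mxE permE IH //=.
    by have := ltn_ord j; lia.
  rewrite -[s.+2 in RHS]card_ord -prodr_const; apply: eq_bigr => i _.
  by rewrite !mxE permE /=; congr L; have := ltn_ord i; lia.
by rewrite dB' => /esym/eqP; rewrite expf_eq0 => /andP[_ /eqP].
Qed.

(** The recurrence is read in the last column of the adjugate of the singular matrix [hankel N0.+1]:
    this column lies in the kernel, and its last entry is the cofactor [\det (hankel N0)], which is
    nonzero. *)
Lemma kronecker_criterion N1 :
  (forall N, (N1 <= N)%N -> \det (hankel N) = 0) ->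
  exists N0 (q : nat -> D), q N0 != 0 /\
    forall i, \sum_(j < N0.+1) q j * a (i + j) = 0.
Proof.
move=> /last_nonsingular_hankel[N0 [dN0 dN]].
pose q j := (\adj (hankel N0.+1)) (inord j) ord_max.
have qN0 : q N0 != 0.
  rewrite /q (_ : inord N0 = ord_max); last by apply/val_inj; rewrite /= inordK.
  rewrite mxE /cofactor -signr_odd oddD addbb mul1r.
  suff -> : row' ord_max (col' ord_max (hankel N0.+1)) = hankel N0 by [].
  by apply/matrixP => i j; rewrite !mxE !lift_max.
exists N0, q; split => //; apply: hankel_recurrence => // i iN0.
have := congr1 (fun A : 'M[D]_N0.+1 => A (inord i) ord_max) (mul_mx_adj (hankel N0.+1)).
rewrite dN // !mxE mul0rn => {2}<-; apply: eq_bigr => j _.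
by rewrite /q inord_val mulrC [X in _ = X * _]mxE inordK ?ltnS.
Qed.

End Hankel.

Notation nrm := Normc.normc.

(** * The complex modulus with values in the real field *)

Section Modulus.
Variable R : rcfType.
Implicit Types z w : R[i].

Lemma normC_nrm z : `|z| = (nrm z)%:C%C.
Proof. by case: z => a b; rewrite normc_def. Qed.

Lemma nrmD z w : nrm (z + w) <= nrm z + nrm w.
Proof. exact: (@le_normcD R z w). Qed.

Lemma nrmN z : nrm (- z) = nrm z.
Proof. exact: (@normcN R z). Qed.

Lemma nrmBC z w : nrm (z - w) = nrm (w - z).
Proof. by rewrite -nrmN opprB. Qed.

Lemma nrmB z w : nrm (z - w) <= nrm z + nrm w.
Proof. by rewrite -(nrmN w) nrmD. Qed.

Lemma nrm_tri u z w : nrm (z - w) <= nrm (z - u) + nrm (u - w).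
Proof. by rewrite -[z - w](subrKA u) nrmD. Qed.

Lemma nrm_ge0 z : 0 <= nrm z.
Proof. by case: z => a b; apply: sqrtr_ge0. Qed.

Lemma nrm0 : nrm (0 : R[i]) = 0. Proof. exact: Normc.normc0. Qed.
Lemma nrm1 : nrm (1 : R[i]) = 1. Proof. exact: Normc.normc1. Qed.

Lemma nrm_eq0 z : (nrm z == 0) = (z == 0).
Proof.
by apply/eqP/eqP => [/Normc.eq0_normc //|->]; rewrite nrm0.
Qed.

Lemma nrm_gt0 z : (0 < nrm z) = (z != 0).
Proof. by rewrite lt_def nrm_ge0 andbT nrm_eq0. Qed.

Lemma nrmM z w : nrm (z * w) = nrm z * nrm w.
Proof. exact: Normc.normcM. Qed.

Lemma nrmV z : nrm z^-1 = (nrm z)^-1.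
Proof. exact: Normc.normcV. Qed.

Lemma nrmX z n : nrm (z ^+ n) = nrm z ^+ n.
Proof. by elim: n => [|n IH]; rewrite ?expr0 ?nrm1 // !exprS nrmM IH. Qed.

Lemma nrm_prod I (r : seq I) P (F : I -> R[i]) :
  nrm (\prod_(i <- r | P i) F i) = \prod_(i <- r | P i) nrm (F i).
Proof. exact: (big_morph _ nrmM nrm1). Qed.

Lemma nrm_sum I (r : seq I) P (F : I -> R[i]) :
  nrm (\sum_(i <- r | P i) F i) <= \sum_(i <- r | P i) nrm (F i).
Proof.
elim/big_ind2: _ => [|x1 x2 y1 y2 h1 h2|//]; first by rewrite nrm0.
by apply: le_trans (nrmD _ _) _; apply: lerD.
Qed.

Lemma nrm_real (x : R) : nrm x%:C%C = `|x|.
Proof. by rewrite /= expr0n /= addr0 sqrtr_sqr. Qed.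

Lemma nrm_nat n : nrm (n%:R : R[i]) = n%:R.
Proof. by rewrite -(rmorph_nat (real_complex R)) nrm_real normr_nat. Qed.

Lemma nrm_int k : nrm (k%:~R : R[i]) = `|k|%:~R.
Proof. by rewrite -(rmorph_int (real_complex R)) nrm_real intr_norm. Qed.

End Modulus.

(** * Discrete contour deformation *)

Section Goursat.
Variable R : realType.
Local Notation C := R[i].
Implicit Types (G : C -> C) (P : R -> R -> C).

(** Complex differentiability at one point, with no continuity of the derivative: the first-order
    estimate is all that Goursat's argument consumes. *)
Definition cdiff G (z : C) : Prop := exists l : C,
  forall e : R, 0 < e -> exists2 d : R, 0 < d & forall w, nrm (w - z) < d ->
    nrm (G w - G z - l * (w - z)) <= e * nrm (w - z).

Definition trap G (u v : C) : C := (G u + G v) / 2 * (v - u).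

Lemma trapE (l c : C) u v :
  trap (fun w => c + l * w) u v =
  (c * v + l * v ^+ 2 / 2) - (c * u + l * u ^+ 2 / 2).
Proof. by rewrite /trap; field. Qed.

Lemma nrm_trap G (m : R) u v : nrm (G u) <= m -> nrm (G v) <= m ->
  nrm (trap G u v) <= m * nrm (v - u).
Proof.
move=> hu hv; rewrite /trap !nrmM nrmV nrm_nat ler_wpM2r ?nrm_ge0 //.
by have := nrmD (G u) (G v); lra.
Qed.

Definition half_pow (n : nat) : R := 2^-1 ^+ n.

Lemma half_pow_gt0 n : 0 < half_pow n.
Proof. by rewrite exprn_gt0 // invr_gt0. Qed.

Lemma half_powS n : half_pow n = 2 * half_pow n.+1.
Proof. by rewrite /half_pow exprS; field. Qed.

Lemma half_powK n : (2 ^ n)%:R * half_pow n = 1.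
Proof. by rewrite natrX /half_pow exprVn mulfV // expf_eq0 pnatr_eq0 andbF. Qed.

Lemma half_powB j n : (j <= n)%N -> (2 ^ (n - j))%:R * half_pow n = half_pow j.
Proof.
move=> jn; rewrite -[in half_pow n](subnK jn) /half_pow exprD mulrA.
by rewrite -/(half_pow _) half_powK mul1r.
Qed.

Lemma half_pow_small (e : R) : 0 < e -> exists n0, forall n, (n0 <= n)%N ->
  half_pow n < e.
Proof.
move=> e0; exists (Num.bound e^-1) => n hn.
have h : e^-1 < (2 ^ n)%:R.
  apply: lt_le_trans (_ : (Num.bound e^-1)%:R <= _).
    by apply: archi_boundP; rewrite invr_ge0 ltW.
  by rewrite ler_nat (leq_trans hn) // ltnW // ltn_expl.
have := half_powK n; have := half_pow_gt0 n.
set x := half_pow n; set y := (2 ^ n)%:R in h * => x0 xy.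
have : 1 < e * y by rewrite mulrC -ltr_pdivrMr // div1r.
nra.
Qed.

(** The intervals of length 2^-j with index [a j] are nested; the supremum of their left ends lies
    in all of them. *)
Lemma nested_dyadic (a : nat -> nat) : a 0%N = 0%N ->
    (forall j, (2 * a j <= a j.+1 <= (2 * a j).+1)%N) ->
  exists x : R, 0 <= x <= 1 /\ forall j,
    (a j)%:R * half_pow j <= x <= (a j).+1%:R * half_pow j.
Proof.
move=> a0 ha; pose x j : R := (a j)%:R * half_pow j.
have xS j : x j <= x j.+1 /\ x j.+1 + half_pow j.+1 <= x j + half_pow j.
  have /andP[h1 h2] := ha j; rewrite /x (half_powS j).
  have := half_pow_gt0 j.+1; set h := half_pow _ => h0.
  have {}h1 : 2 * (a j)%:R <= (a j.+1)%:R :> R by rewrite -natrM ler_nat.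
  have {}h2 : (a j.+1)%:R <= 2 * (a j)%:R + 1 :> R by rewrite -natrM natr1 ler_nat.
  by split; nra.
have xm i j : (i <= j)%N -> x i <= x j /\ x j + half_pow j <= x i + half_pow i.
  move=> /subnK <-; elim: (j - i)%N => [|k [h1 h2]]; first by rewrite add0n.
  by have [] := xS (k + i)%N; rewrite addSn; lra.
have xb i j : x i <= x j + half_pow j.
  have := half_pow_gt0 i; have := half_pow_gt0 j.
  by case/orP: (leq_total i j) => /xm; lra.
have hs : has_sup (range x).
  by split; [exists (x 0%N), 0%N|exists (x 0%N + half_pow 0) => _ [i _ <-]].
have lo j : x j <= sup (range x) by apply: sup_upper_bound => //; exists j.
have hi j : sup (range x) <= x j + half_pow j.
  by apply: ge_sup => [|_ [i _ <-]//]; exists (x 0%N), 0%N.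
exists (sup (range x)); split.
  have := lo 0%N; have := hi 0%N; rewrite /x /half_pow a0 expr0 mul0r; lra.
by move=> j; rewrite lo -natr1 mulrDl mul1r hi.
Qed.

Section Grid.
Variable P : R -> R -> C.

Definition node n i l : C := P (i%:R * half_pow n) (l%:R * half_pow n).

(* The trapezoidal sum of G along the boundary of the image of the cell
   [i0, i1] x [l0, l1] of the grid of mesh 2^-n. *)
Definition bsum G n i0 i1 l0 l1 : C :=
  \sum_(i0 <= i < i1) (trap G (node n i l0) (node n i.+1 l0) -
                       trap G (node n i l1) (node n i.+1 l1)) +
  \sum_(l0 <= l < l1) (trap G (node n i1 l) (node n i1 l.+1) -
                       trap G (node n i0 l) (node n i0 l.+1)).

(** Edges interior to the large rectangle are traversed once in each direction and cancel. *)
Lemma bsum_split G n i0 i1 i2 l0 l1 l2 :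
    (i0 <= i1 <= i2)%N -> (l0 <= l1 <= l2)%N ->
  bsum G n i0 i2 l0 l2 = bsum G n i0 i1 l0 l1 + bsum G n i0 i1 l1 l2 +
                        (bsum G n i1 i2 l0 l1 + bsum G n i1 i2 l1 l2).
Proof.
move=> /andP[i01 i12] /andP[l01 l12]; rewrite /bsum !sumrB.
rewrite !(big_cat_nat i01 i12) !(big_cat_nat l01 l12) /=.
ring.
Qed.

Lemma bsum_affine (l c : C) n i0 i1 l0 l1 : (i0 <= i1)%N -> (l0 <= l1)%N ->
  bsum (fun w => c + l * w) n i0 i1 l0 l1 = 0.
Proof.
move=> i01 l01; pose F w := c * w + l * w ^+ 2 / 2.
have tE u v : trap (fun w => c + l * w) u v = F v - F u by exact: trapE.
rewrite /bsum !sumrB.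
have tel (f : nat -> C) (k0 k1 : nat) : (k0 <= k1)%N ->
    \sum_(k0 <= k < k1) trap (fun w => c + l * w) (f k) (f k.+1) =
    F (f k1) - F (f k0).
  by move=> k01; under eq_bigr do rewrite tE; rewrite (telescope_sumr (F \o f)).
by rewrite !(tel (fun k => node n k _) _ _ i01) !(tel (node n _) _ _ l01); ring.
Qed.

Lemma bsumB G1 G2 n i0 i1 l0 l1 :
  bsum (fun w => G1 w - G2 w) n i0 i1 l0 l1 =
  bsum G1 n i0 i1 l0 l1 - bsum G2 n i0 i1 l0 l1.
Proof.
have tB u v : trap (fun w => G1 w - G2 w) u v = trap G1 u v - trap G2 u v.
  by rewrite /trap; ring.
rewrite /bsum opprD addrACA -!sumrB; congr (_ + _); apply: eq_bigr => *;
  rewrite !tB; ring.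
Qed.

Lemma nrm_bsum G n i0 i1 l0 l1 (m h : R) : 0 <= m ->
    (i0 <= i1)%N -> (l0 <= l1)%N ->
    (forall i l, (i0 <= i <= i1)%N -> (l0 <= l <= l1)%N ->
       nrm (G (node n i l)) <= m) ->
    (forall i l, (i0 <= i < i1)%N -> (l0 <= l <= l1)%N ->
       nrm (node n i.+1 l - node n i l) <= h) ->
    (forall i l, (i0 <= i <= i1)%N -> (l0 <= l < l1)%N ->
       nrm (node n i l.+1 - node n i l) <= h) ->
  nrm (bsum G n i0 i1 l0 l1) <= 2 * ((i1 - i0) + (l1 - l0))%:R * (m * h).
Proof.
move=> m0 i01 l01 hG hi hl.
have tr u v : nrm (G u) <= m -> nrm (G v) <= m -> nrm (v - u) <= h ->
    nrm (trap G u v) <= m * h.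
  by move=> hu hv huv; apply: le_trans (nrm_trap hu hv) _; apply: ler_wpM2l.
rewrite /bsum natrD mulrDr mulrDl.
apply: le_trans (nrmD _ _) _; apply: lerD.
  apply: le_trans (nrm_sum _ _ _) _; rewrite -mulrA mulrCA mulr_natl.
  rewrite -sumr_const_nat [leLHS]big_nat [leRHS]big_nat.
  apply: ler_sum => i /andP[h1 h2]; apply: le_trans (nrmB _ _) _.
  have := tr (node n i l0) (node n i.+1 l0).
  have := tr (node n i l1) (node n i.+1 l1).
  rewrite !hG ?hi ?leqnn ?l01 ?h1 ?h2 ?(ltnW h2) ?(leq_trans h1) //.
  by move=> /(_ erefl erefl erefl) k1 /(_ erefl erefl erefl) k2; lra.
apply: le_trans (nrm_sum _ _ _) _; rewrite -mulrA mulrCA mulr_natl.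
rewrite -sumr_const_nat [leLHS]big_nat [leRHS]big_nat.
apply: ler_sum => i /andP[h1 h2]; apply: le_trans (nrmB _ _) _.
have := tr (node n i0 i) (node n i0 i.+1).
have := tr (node n i1 i) (node n i1 i.+1).
rewrite !hG ?hl ?leqnn ?i01 ?h1 ?h2 ?(ltnW h2) ?(leq_trans h1) //.
by move=> /(_ erefl erefl erefl) k1 /(_ erefl erefl erefl) k2; lra.
Qed.

(** The level [j] of the cell and the mesh [n] of the sum are independent: a cell stays fixed while
    the sums along its boundary are refined. *)
Definition cell_sum G n j a b :=
  bsum G n (a * 2 ^ (n - j)) (a.+1 * 2 ^ (n - j))
           (b * 2 ^ (n - j)) (b.+1 * 2 ^ (n - j)).

Lemma cell_sum_split G n j a b : (j < n)%N ->
  cell_sum G n j a b =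
  cell_sum G n j.+1 (2 * a) (2 * b) + cell_sum G n j.+1 (2 * a) (2 * b).+1 +
  (cell_sum G n j.+1 (2 * a).+1 (2 * b) +
   cell_sum G n j.+1 (2 * a).+1 (2 * b).+1).
Proof.
move=> jn; rewrite /cell_sum (_ : n - j = (n - j.+1).+1)%N; last by lia.
set k := (2 ^ (n - j.+1))%N; rewrite expnS -/k.
rewrite (@bsum_split _ _ _ ((2 * a).+1 * k) _ _ ((2 * b).+1 * k)); try nia.
have e1 c : (c * (2 * k) = 2 * c * k)%N by nia.
have e2 c : (c.+1 * (2 * k) = (2 * c).+2 * k)%N by nia.
by rewrite !e2 !e1.
Qed.

Lemma grid_point n j a i : (j <= n)%N ->
    (a * 2 ^ (n - j) <= i <= a.+1 * 2 ^ (n - j))%N ->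
  a%:R * half_pow j <= i%:R * half_pow n <= a.+1%:R * half_pow j.
Proof.
move=> jn /andP[h1 h2]; rewrite -(half_powB jn) !mulrA -!natrM.
by rewrite !ler_pM2r ?half_pow_gt0 // !ler_nat h1 h2.
Qed.

Lemma grid_point01 j a (x : R) : (a < 2 ^ j)%N ->
  a%:R * half_pow j <= x <= a.+1%:R * half_pow j -> 0 <= x <= 1.
Proof.
move=> aj /andP[h1 h2]; apply/andP; split.
  by apply: le_trans h1; rewrite mulr_ge0 // ltW // half_pow_gt0.
apply: le_trans h2 _; rewrite -[leRHS](half_powK j) ler_pM2r ?half_pow_gt0 //.
by rewrite ler_nat.
Qed.

Lemma grid_dist j a (x x' : R) :
  a%:R * half_pow j <= x <= a.+1%:R * half_pow j ->
  a%:R * half_pow j <= x' <= a.+1%:R * half_pow j ->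
  `|x - x'| <= half_pow j.
Proof.
rewrite -natr1 mulrDl mul1r => /andP[h1 h2] /andP[h3 h4].
by rewrite ler_norml; apply/andP; split; lra.
Qed.

Variable K : R.
Hypothesis K_ge0 : 0 <= K.
Hypothesis P_lip : forall x y x' y' : R, 0 <= x <= 1 -> 0 <= y <= 1 ->
  0 <= x' <= 1 -> 0 <= y' <= 1 ->
  nrm (P x y - P x' y') <= K * (`|x - x'| + `|y - y'|).

(** Subtracting the tangent affine function does not change the sum. The remainder is at most [e1]
    times the distance to [P x y], along a boundary of length of order [half_pow j]; this produces
    the square of the side. *)
Lemma cell_sum_small G (x y e : R) : 0 <= x <= 1 -> 0 <= y <= 1 ->
    cdiff G (P x y) -> 0 < e ->
  exists2 d : R, 0 < d & forall n j a b, (j <= n)%N -> half_pow j < d ->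
    (a < 2 ^ j)%N -> (b < 2 ^ j)%N ->
    a%:R * half_pow j <= x <= a.+1%:R * half_pow j ->
    b%:R * half_pow j <= y <= b.+1%:R * half_pow j ->
    nrm (cell_sum G n j a b) <= e * half_pow j ^+ 2.
Proof.
move=> x01 y01 [l hl] e0.
have K0 := K_ge0.
(* The boundary has 4 * 2^(n-j) edges, each of length at most [K * half_pow n], and its points are
   within [2 * K * half_pow j] of [P x y]; the product is 8 K^2 [e1] times the squared side. *)
pose e1 := e / (8 * K ^+ 2 + 1).
have K2 : 0 <= K ^+ 2 by apply: sqr_ge0.
have e10 : 0 < e1 by apply: divr_gt0 => //; lra.
have [d0 d00 hd] := hl _ e10.
exists (d0 / (2 * K + 1)) => [|n j a b jn hj aj bj xa yb].
  by apply: divr_gt0 => //; lra.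
have hj0 := half_pow_gt0 j.
have dist i k : (a * 2 ^ (n - j) <= i <= a.+1 * 2 ^ (n - j))%N ->
    (b * 2 ^ (n - j) <= k <= b.+1 * 2 ^ (n - j))%N ->
    nrm (node n i k - P x y) <= 2 * K * half_pow j.
  move=> /(grid_point jn) hi /(grid_point jn) hk.
  apply: le_trans (P_lip _ _ x01 y01) _; try exact: grid_point01; try eassumption.
  + exact: (grid_point01 aj).
  + exact: (grid_point01 bj).
  have := grid_dist hi xa; have := grid_dist hk yb; nra.
pose c := G (P x y) - l * P x y.
have -> : cell_sum G n j a b =
    bsum (fun w => G w - (c + l * w)) n (a * 2 ^ (n - j)) (a.+1 * 2 ^ (n - j))
           (b * 2 ^ (n - j)) (b.+1 * 2 ^ (n - j)).
  by rewrite bsumB bsum_affine ?subr0 // leq_pmul2r ?expn_gt0.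
have lip_h i k i' k' : (a * 2 ^ (n - j) <= i <= a.+1 * 2 ^ (n - j))%N ->
    (b * 2 ^ (n - j) <= k <= b.+1 * 2 ^ (n - j))%N ->
    (a * 2 ^ (n - j) <= i' <= a.+1 * 2 ^ (n - j))%N ->
    (b * 2 ^ (n - j) <= k' <= b.+1 * 2 ^ (n - j))%N ->
    nrm (node n i k - node n i' k') <=
      K * (`|i%:R - i'%:R| + `|k%:R - k'%:R|) * half_pow n.
  move=> /(grid_point jn) hi /(grid_point jn) hk /(grid_point jn) hi' /(grid_point jn) hk'.
  apply: le_trans (P_lip _ _ _ _) _.
  + exact: (grid_point01 aj).
  + exact: (grid_point01 bj).
  + exact: (grid_point01 aj).
  + exact: (grid_point01 bj).
  by rewrite -!mulrBl !normrM (ger0_norm (ltW (half_pow_gt0 n))) -mulrDl mulrA.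
have bnd := @nrm_bsum (fun w => G w - (c + l * w)) n (a * 2 ^ (n - j))
  (a.+1 * 2 ^ (n - j)) (b * 2 ^ (n - j)) (b.+1 * 2 ^ (n - j))
  (e1 * (2 * K * half_pow j)) (K * half_pow n).
apply: le_trans (bnd _ _ _ _ _ _) _.
- by apply: mulr_ge0; [exact: ltW|apply: mulr_ge0; [lra|exact: ltW]].
- by rewrite leq_pmul2r ?expn_gt0.
- by rewrite leq_pmul2r ?expn_gt0.
- move=> i k hi hk; have hd1 := dist _ _ hi hk.
  have -> : G (node n i k) - (c + l * node n i k) =
      G (node n i k) - G (P x y) - l * (node n i k - P x y).
    by rewrite /c; ring.
  apply: le_trans (hd _ _) _; last by rewrite ler_pM2l.
  apply: le_lt_trans hd1 _; move: hj; rewrite ltr_pdivlMr; last by lra.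
  by nra.
- move=> i k /andP[h1 h2] hk; apply: le_trans (lip_h _ _ _ _ _ hk _ hk) _.
  + by rewrite (leq_trans h1).
  + by rewrite h1 ltnW.
  by rewrite -natr1 addrAC !subrr add0r normr1 normr0 addr0 mulr1.
- move=> i k hi /andP[h1 h2]; apply: le_trans (lip_h _ _ _ _ hi _ hi _) _.
  + by rewrite (leq_trans h1).
  + by rewrite h1 ltnW.
  by rewrite -natr1 addrAC !subrr add0r normr1 normr0 add0r mulr1.
have -> : (a.+1 * 2 ^ (n - j) - a * 2 ^ (n - j) +
          (b.+1 * 2 ^ (n - j) - b * 2 ^ (n - j)) = 2 * 2 ^ (n - j))%N.
  by rewrite !mulSn !addnK mul0n addn0.
rewrite natrM.
have -> : 2 * (2%:R * (2 ^ (n - j))%:R) * (e1 * (2 * K * half_pow j) * (K * half_pow n)) =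
   8 * K ^+ 2 * e1 * half_pow j * ((2 ^ (n - j))%:R * half_pow n) by ring.
rewrite half_powB // -mulrA -expr2 ler_pM2r ?exprn_gt0 //.
by rewrite /e1 mulrA ler_pdivrMr; nra.
Qed.

End Grid.

(** The second alternative serves the arc that stays put during the deformation: where [P] does not
    depend on its first argument the cells are degenerate, and nothing is asked of [G]. *)
Theorem discrete_goursat (P : R -> R -> C) (K : R) (G : C -> C) :
    0 <= K ->
    (forall x y x' y' : R, 0 <= x <= 1 -> 0 <= y <= 1 -> 0 <= x' <= 1 -> 0 <= y' <= 1 ->
       nrm (P x y - P x' y') <= K * (`|x - x'| + `|y - y'|)) ->
    (forall x y : R, 0 <= x <= 1 -> 0 <= y <= 1 -> cdiff G (P x y) \/
       exists2 d : R, 0 < d & forall x1 x2 y' : R, `|y' - y| < d -> P x1 y' = P x2 y') ->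
  forall e : R, 0 < e -> exists n0, forall n, (n0 <= n)%N ->
    nrm (bsum P G n 0 (2 ^ n) 0 (2 ^ n)) <= e.
Proof.
move=> K0 P_lip P_diff e e0.
(* Bisection: a bad dyadic square has a bad quarter. *)
pose good j a b := exists n0, forall n, (n0 <= n)%N ->
  nrm (cell_sum P G n j a b) <= e * half_pow j ^+ 2.
suff [n0 hn0] : good 0%N 0%N 0%N.
  exists n0 => n /hn0; rewrite /cell_sum subn0 mul0n mul1n.
  by rewrite /half_pow expr0 expr1n mulr1.
apply: contrapT => bad0.
pose next (p : nat * nat * nat) (q : nat * nat) := ~ good p.1.1 p.1.2 p.2 ->
    [/\ ~ good p.1.1.+1 q.1 q.2, (2 * p.1.2 <= q.1 <= (2 * p.1.2).+1)%N &
        (2 * p.2 <= q.2 <= (2 * p.2).+1)%N].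
have [f hf] : {f & forall p, next p (f p)}.
  apply: choice => -[[j a] b]; rewrite /next /=.
  have [g|ng] := pselect (good j a b); first by exists (0%N, 0%N).
  apply: contrapT => nex; apply: ng.
  have sub a' b' : (2 * a <= a' <= (2 * a).+1)%N -> (2 * b <= b' <= (2 * b).+1)%N ->
      good j.+1 a' b'.
    by move=> ha hb; apply: contrapT => ng; apply: nex; exists (a', b').
  have [n1 h1] : good j.+1 (2 * a)%N (2 * b)%N by apply: sub; lia.
  have [n2 h2] : good j.+1 (2 * a)%N (2 * b).+1 by apply: sub; lia.
  have [n3 h3] : good j.+1 (2 * a).+1 (2 * b)%N by apply: sub; lia.
  have [n4 h4] : good j.+1 (2 * a).+1 (2 * b).+1 by apply: sub; lia.
  exists (j.+1 + (n1 + n2 + n3 + n4))%N => n hn.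
  rewrite cell_sum_split; last by lia.
  rewrite half_powS exprMn.
  apply: le_trans (nrmD _ _) _; apply: le_trans (lerD (nrmD _ _) (nrmD _ _)) _.
  have {}h1 := h1 n ltac:(lia); have {}h2 := h2 n ltac:(lia).
  have {}h3 := h3 n ltac:(lia); have {}h4 := h4 n ltac:(lia).
  by lra.
pose s := fix s j : nat * nat :=
  if j is j'.+1 then f (j', (s j').1, (s j').2) else (0%N, 0%N).
have sbad j : ~ good j (s j).1 (s j).2.
  by elim: j => [//|j IH]; have [] := hf (j, (s j).1, (s j).2) IH.
have [x [x01 hx]] : exists x : R, 0 <= x <= 1 /\ forall j,
    (s j).1%:R * half_pow j <= x <= (s j).1.+1%:R * half_pow j.
  apply: nested_dyadic => // j.
  by have [] := hf (j, (s j).1, (s j).2) (sbad j).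
have [y [y01 hy]] : exists x : R, 0 <= x <= 1 /\ forall j,
    (s j).2%:R * half_pow j <= x <= (s j).2.+1%:R * half_pow j.
  apply: nested_dyadic => // j.
  by have [] := hf (j, (s j).1, (s j).2) (sbad j).
have sj1 j : ((s j).1 < 2 ^ j)%N /\ ((s j).2 < 2 ^ j)%N.
  elim: j => [//|j [IH1 IH2]]; rewrite expnS.
  have [_] := hf (j, (s j).1, (s j).2) (sbad j); rewrite -/(s j.+1) /=; lia.
(* The bad squares shrink to [(x, y)]. Either the tangent estimate contradicts their badness, or a
   small one has two edges reduced to points and two that coincide, so that its sum is 0. *)
have [hd|[d d0 hd]] := P_diff x y x01 y01.
  have [d d0 hd1] := cell_sum_small K0 P_lip x01 y01 hd e0.
  have [j0 hj0] := half_pow_small d0.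
  apply: (sbad j0); exists j0 => n hn; have [s1 s2] := sj1 j0.
  by apply: hd1 => //; apply: hj0.
have [j0 hj0] := half_pow_small d0.
apply: (sbad j0); exists j0 => n hn.
have eqP i i' k : ((s j0).2 * 2 ^ (n - j0) <= k <= (s j0).2.+1 * 2 ^ (n - j0))%N ->
    node P n i k = node P n i' k.
  move=> /(grid_point hn) hk; apply: hd.
  by apply: le_lt_trans (hj0 _ (leqnn _)); apply: grid_dist hk (hy j0).
have trap0 u : trap G u u = 0 by rewrite /trap subrr mulr0.
rewrite /cell_sum /bsum big_nat big1 ?add0r => [|i _]; last first.
  by rewrite !(@eqP i.+1 i) ?trap0 ?subrr //; rewrite leqnn leq_mul2r leqnSn orbT.
rewrite big_nat big1 ?nrm0 => [|k /andP[h1 h2]].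
  by rewrite mulr_ge0 ?sqr_ge0 // ltW.
rewrite !(@eqP ((s j0).1.+1 * 2 ^ (n - j0))%N ((s j0).1 * 2 ^ (n - j0))%N) ?subrr //.
  by rewrite h2 (leq_trans h1).
by rewrite h1 ltnW.
Qed.

End Goursat.

(** * Stability of complex differentiability *)

Section Cdiff.
Variable R : realType.
Local Notation C := R[i].
Implicit Types (G H : C -> C) (z : C).

Lemma cdiff_cst (c : C) z : cdiff (fun=> c) z.
Proof.
exists 0 => e e0; exists 1 => // w _.
by rewrite mul0r subr0 subrr nrm0 mulr_ge0 ?nrm_ge0 // ltW.
Qed.

Lemma cdiff_id z : cdiff id z.
Proof.
exists 1 => e e0; exists 1 => // w _.
by rewrite mul1r subrr nrm0 mulr_ge0 ?nrm_ge0 // ltW.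
Qed.

Lemma cdiffD G H z : cdiff G z -> cdiff H z -> cdiff (fun w => G w + H w) z.
Proof.
move=> [l1 h1] [l2 h2]; exists (l1 + l2) => e e0.
have e20 : 0 < e / 2 by rewrite divr_gt0.
have [d1 d10 {}h1] := h1 _ e20; have [d2 d20 {}h2] := h2 _ e20.
exists (Num.min d1 d2) => [|w]; first by rewrite lt_min d10.
rewrite lt_min => /andP[/h1 {}h1 /h2 {}h2].
rewrite [X in nrm X <= _](_ : _ = (G w - G z - l1 * (w - z)) + (H w - H z - l2 * (w - z))).
  by apply: le_trans (nrmD _ _) _; lra.
by ring.
Qed.

Lemma cdiff_lip G z : cdiff G z -> exists2 c : R, 0 < c & exists2 d : R, 0 < d &
  forall w, nrm (w - z) < d -> nrm (G w - G z) <= c * nrm (w - z).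
Proof.
move=> [l hl]; have [d d0 hd] := hl 1 ltr01.
exists (nrm l + 1); first by rewrite ltr_wpDl ?nrm_ge0.
exists d => // w /hd h; rewrite -[G w - G z](subrK (l * (w - z))).
by apply: le_trans (nrmD _ _) _; rewrite nrmM; lra.
Qed.

Lemma cdiffM G H z : cdiff G z -> cdiff H z -> cdiff (fun w => G w * H w) z.
Proof.
move=> dG dH; have [c1 c10 [d1 d10 k1]] := cdiff_lip dG.
have [c2 c20 [d2 d20 k2]] := cdiff_lip dH.
move: dG dH => [l1 h1] [l2 h2]; exists (l1 * H z + G z * l2) => e e0.
have nG := nrm_ge0 (G z); have nH := nrm_ge0 (H z).
have [d3 d30 {}h1] := h1 (e / (3 * (nrm (H z) + 1))) ltac:(apply: divr_gt0; lra).
have [d4 d40 {}h2] := h2 (e / (3 * (nrm (G z) + 1))) ltac:(apply: divr_gt0; lra).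
pose d5 := e / (3 * (c1 * c2)).
have d50 : 0 < d5 by rewrite divr_gt0 // !mulr_gt0.
exists (Num.min (Num.min d1 d2) (Num.min (Num.min d3 d4) d5)) => [|w].
  by rewrite !lt_min d10 d20 d30 d40 d50.
rewrite !lt_min => /andP[/andP[/k1 {}k1 /k2 {}k2] /andP[/andP[/h1 {}h1 /h2 {}h2] h5]].
rewrite [X in nrm X <= _](_ : _ = (G w - G z - l1 * (w - z)) * H z +
  G z * (H w - H z - l2 * (w - z)) + (G w - G z) * (H w - H z)); last by ring.
set d := nrm (w - z) in h1 h2 k1 k2 h5 *.
have d0 : 0 <= d by apply: nrm_ge0.
apply: le_trans (nrmD _ _) _; apply: le_trans (lerD (nrmD _ _) (lexx _)) _.
rewrite !nrmM.
have b1 : nrm (G w - G z - l1 * (w - z)) * nrm (H z) <= e / 3 * d.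
  have -> : e / 3 * d = e / (3 * (nrm (H z) + 1)) * d * (nrm (H z) + 1).
    by field; rewrite gt_eqF //; lra.
  by apply: ler_pM; rewrite ?nrm_ge0 //; lra.
have b2 : nrm (G z) * nrm (H w - H z - l2 * (w - z)) <= e / 3 * d.
  have -> : e / 3 * d = (nrm (G z) + 1) * (e / (3 * (nrm (G z) + 1)) * d).
    by field; rewrite gt_eqF //; lra.
  by apply: ler_pM; rewrite ?nrm_ge0 //; lra.
have b3 : nrm (G w - G z) * nrm (H w - H z) <= e / 3 * d.
  apply: (@le_trans _ _ (c1 * d * (c2 * d))).
    by apply: ler_pM; rewrite ?nrm_ge0.
  have -> : c1 * d * (c2 * d) = (c1 * c2) * d * d by ring.
  apply: ler_wpM2r => //.
  have -> : e / 3 = (c1 * c2) * d5 by rewrite /d5; field; rewrite !gt_eqF.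
  by rewrite ler_pM2l ?mulr_gt0 // ltW.
by lra.
Qed.

Lemma cdiff_inv z : z != 0 -> cdiff (fun w => w^-1) z.
Proof.
move=> z0; exists (- (z ^+ 2)^-1) => e e0.
have nz : 0 < nrm z by rewrite nrm_gt0.
pose d1 := e * nrm z ^+ 3 / 2.
have d10 : 0 < d1 by rewrite divr_gt0 // mulr_gt0 // exprn_gt0.
exists (Num.min (nrm z / 2) d1) => [|w]; first by rewrite lt_min divr_gt0.
rewrite lt_min => /andP[h1 h2].
have nw : nrm z / 2 < nrm w.
  have := nrmD (z - w) w; rewrite subrK nrmBC; lra.
have w0 : w != 0 by rewrite -nrm_gt0; lra.
rewrite [X in nrm X <= _](_ : _ = (w - z) * (w - z) / (z ^+ 2 * w)); last by field; rewrite z0 w0.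
rewrite !nrmM -mulrA [leRHS]mulrC; apply: ler_wpM2l; first exact: nrm_ge0.
rewrite nrmV nrmM nrmX ler_pdivrMr; last by rewrite mulr_gt0 ?exprn_gt0 //; lra.
apply: le_trans (ltW h2) _.
have -> : d1 = e * (nrm z ^+ 2 * (nrm z / 2)) by rewrite /d1; ring.
by rewrite ler_pM2l // ler_pM2l ?exprn_gt0 // ltW.
Qed.

Lemma cdiff_horner_inv (p : {poly C}) z : z != 0 -> cdiff (fun w => p.[w^-1]) z.
Proof.
move=> z0; elim/poly_ind: p => [|p c IH].
  by under eq_fun do rewrite horner0; exact: cdiff_cst.
under eq_fun do rewrite hornerMXaddC.
apply: cdiffD; last exact: cdiff_cst.
by apply: cdiffM => //; exact: cdiff_inv.
Qed.

End Cdiff.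

(** * The unit circle: Lipschitz bounds and roots of unity *)

Section Expi.
Variable R : realType.
Local Notation C := R[i].
Implicit Types s t : R.

Lemma expi0 : expi (0 : R) = 1.
Proof. by rewrite /expi cos0 sin0. Qed.

Lemma expiD s t : expi (s + t) = expi s * expi t.
Proof. by rewrite /expi cosD sinD; simpc; rewrite [sin s * cos t + _]addrC. Qed.

Lemma expiMn t k : expi (t *+ k) = expi t ^+ k.
Proof. by elim: k => [|k IH]; rewrite ?expi0 // mulrS exprS expiD IH. Qed.

Lemma nrm_expi t : nrm (expi t) = 1.
Proof. by rewrite /= cos2Dsin2 sqrtr1. Qed.

Lemma expi_neq0 t : expi t != 0.
Proof. by rewrite -nrm_gt0 nrm_expi. Qed.

Lemma expi2pi : expi (pi *+ 2 : R) = 1.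
Proof. by rewrite /expi cos2pi sin2pi. Qed.

Lemma nrm_expiB1 t : nrm (expi t - 1) ^+ 2 = 2 - 2 * cos t.
Proof.
rewrite /= sqr_sqrtr ?addr_ge0 ?sqr_ge0 // oppr0 addr0.
have := cos2Dsin2 t; move: (cos t) (sin t) => c s; nra.
Qed.

Lemma expi_neq1 t : 0 < t < pi *+ 2 -> expi t != 1.
Proof.
move=> /andP[t0 t2]; rewrite -subr_eq0 -nrm_gt0 lt_neqAle nrm_ge0 andbT eq_sym.
apply/negP => /eqP n0; have := nrm_expiB1 t; rewrite n0 expr0n /=.
have st : 0 < sin (t / 2).
  by apply: sin_gt0_pi; move: t2; rewrite -mulr_natr => t2; lra.
have : cos t = 1 - 2 * sin (t / 2) ^+ 2.
  have {1}-> : t = (t / 2) *+ 2 by rewrite -mulr_natr; field.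
  rewrite cos_mulr2n mulr2n; have := cos2Dsin2 (t / 2).
  by move: (cos _) (sin _) => c s; lra.
by move: st (cos t) => /[swap] c; move: (sin _) => s; nra.
Qed.

Lemma cos_lip s t : `|cos s - cos t| <= `|s - t|.
Proof.
wlog st : s t / t <= s.
  move=> h; case: (leP t s) => [/h //|/ltW /h].
  by rewrite distrC [X in _ <= X]distrC.
have [c _ ->] := @MVT_segment R cos (fun x => - sin x) t s st
  (fun x _ => is_derive_cos x) (continuous_subspaceT (@continuous_cos R)).
by rewrite normrM normrN ler_piMl // ler_norml sin_geN1 sin_le1.
Qed.

Lemma sin_lip s t : `|sin s - sin t| <= `|s - t|.
Proof.
wlog st : s t / t <= s.
  move=> h; case: (leP t s) => [/h //|/ltW /h].
  by rewrite distrC [X in _ <= X]distrC.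
have [c _ ->] := @MVT_segment R sin cos t s st
  (fun x _ => is_derive_sin x) (continuous_subspaceT (@continuous_sin R)).
by rewrite normrM ler_piMl // ler_norml cos_geN1 cos_le1.
Qed.

Lemma expi_lip s t : nrm (expi s - expi t) <= 2 * `|s - t|.
Proof.
have h1 := cos_lip s t; have h2 := sin_lip s t; have h0 := normr_ge0 (s - t).
rewrite -(@ler_pXn2r _ 2) ?nnegrE ?nrm_ge0 ?mulr_ge0 //=.
rewrite sqr_sqrtr ?addr_ge0 ?sqr_ge0 //.
rewrite -(real_normK (num_real (cos s - cos t))).
rewrite -(real_normK (num_real (sin s - sin t))).
have := normr_ge0 (cos s - cos t); have := normr_ge0 (sin s - sin t).
move: h1 h2 h0.
by move: `|cos s - cos t| `|sin s - sin t| `|s - t| => a b c; nra.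
Qed.

(** Orthogonality of characters. With exponents below [M] there is no aliasing, so a finite average
    extracts a coefficient exactly; this replaces every Fourier integral of the proof. *)
Lemma root_of_unity_sum (M e k : nat) : (e < M)%N -> (k < M)%N ->
  \sum_(l < M) (expi (pi *+ 2 * (l%:R / M%:R)) ^+ e *
                (expi (pi *+ 2 * (l%:R / M%:R)))^-1 ^+ k) =
  (if e == k then M%:R else 0) :> C.
Proof.
move=> eM kM; pose om : C := expi (pi *+ 2 / M%:R).
have M0 : M%:R != 0 :> R by rewrite pnatr_eq0; lia.
have omE l : expi (pi *+ 2 * (l%:R / M%:R)) = om ^+ l.
  by rewrite -expiMn -mulr_natr; congr expi; field.
have om0 : om != 0 by apply: expi_neq0.
have omM : om ^+ M = 1 by rewrite -expiMn -(mulr_natr (_ / _) M) divfK // expi2pi.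
pose q := om ^+ e / om ^+ k.
under eq_bigr => l _ do
  rewrite omE exprVn -!exprM [(l * e)%N]mulnC [(l * k)%N]mulnC !exprM -expr_div_n -/q.
case: eqP => [ek|nek].
  under eq_bigr do rewrite /q ek divff ?expf_neq0 // expr1n.
  by rewrite sumr_const card_ord.
have q1 : q != 1.
  have lt01 d : (0 < d < M)%N -> om ^+ d != 1.
    move=> /andP[d0 dM]; rewrite -expiMn; apply: expi_neq1.
    have p0 : 0 < pi *+ 2 :> R by rewrite pmulrn_lgt0 // pi_gt0.
    have MR : 0 < M%:R :> R by rewrite ltr0n; lia.
    rewrite -(mulr_natr (_ / _) d) -mulrA; apply/andP; split.
      by rewrite !mulr_gt0 ?invr_gt0 // ltr0n.
    rewrite -[X in _ < X]mulr1 ltr_pM2l //.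
    by rewrite mulrC ltr_pdivrMr ?mul1r ?ltr_nat.
  case: (ltngtP e k) => [ek|ke|//].
    apply: contra (lt01 (k - e)%N _) => [/eqP h|]; last by lia.
    have : q * om ^+ (k - e) = 1.
      by rewrite /q mulrAC -exprD subnKC ?divff ?expf_neq0 // ltnW.
    by rewrite h mul1r => ->.
  apply: contra (lt01 (e - k)%N _) => [/eqP h|]; last by lia.
  by rewrite -h /q -[in X in _ == X / _](subnK (ltnW ke)) exprD mulfK ?expf_neq0.
have : (q - 1) * (\sum_(l < M) q ^+ l) = 0.
  by rewrite -subrX1 /q expr_div_n -!exprM ![(_ * M)%N]mulnC !exprM omM !expr1n divr1 subrr.
by move=> /eqP; rewrite mulf_eq0 subr_eq0 (negPf q1) => /eqP.
Qed.

(** The number in question has 2^(n-3)-th power exp (i pi/2), at distance at least 1 from 1, and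
    |q^k - 1| <= k |q - 1| when |q| = 1. The bound is what allows division by the step of the
    trapezoidal sum on a circle. *)
Lemma root_of_unity_gap n : (3 <= n)%N ->
  8 <= (2 ^ n)%:R * nrm (expi (pi *+ 2 * half_pow R n) ^+ 2 - 1).
Proof.
move=> n3; pose q : C := expi (pi *+ 2 * half_pow R n) ^+ 2.
have h k : nrm (q ^+ k - 1) <= k%:R * nrm (q - 1).
  rewrite subrX1 nrmM mulrC; apply: ler_wpM2r; first exact: nrm_ge0.
  apply: le_trans (nrm_sum _ _ _) _.
  under eq_bigr do rewrite nrmX /q nrmX nrm_expi !expr1n.
  by rewrite sumr_const card_ord.
have := h (2 ^ (n - 3))%N.
have -> : q ^+ (2 ^ (n - 3)) = expi (pi / 2).
  rewrite /q -exprM -expiMn -(mulr_natr (_ * _) (2 * _)%N) natrM; congr expi.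
  rewrite -(mulr_natr pi 2).
  have -> : pi * 2 * half_pow R n * (2 * (2 ^ (n - 3))%:R) =
            pi * 4 * ((2 ^ (n - 3))%:R * half_pow R n) by ring.
  by rewrite half_powB // /half_pow; field.
have : 1 <= nrm (expi (pi / 2) - 1 : C).
  rewrite -(@ler_pXn2r _ 2) ?nnegrE ?nrm_ge0 // nrm_expiB1 cos_pihalf expr1n; lra.
rewrite -/q; have -> : (2 ^ n)%:R = 8 * (2 ^ (n - 3))%:R :> R.
  by rewrite -[in LHS](subnK n3) expnD natrM mulrC; congr (_ * _).
lra.
Qed.

End Expi.

(** * Decay of Hankel determinants *)

Section ArcPolynomial.
Variable R : realType.
Local Notation C := R[i].

Lemma bernoulli_ineq (x : R) k : -1 <= x -> 1 + k%:R * x <= (1 + x) ^+ k.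
Proof.
move=> x1; elim: k => [|k IH]; first by rewrite mul0r addr0.
rewrite exprS -natr1; apply: (@le_trans _ _ ((1 + x) * (1 + k%:R * x))).
  have : 0 <= k%:R * x ^+ 2 by rewrite mulr_ge0 ?sqr_ge0.
  by lra.
by apply: ler_wpM2l => //; lra.
Qed.

Lemma expr_small (q e : R) : 0 < q < 1 -> 0 < e ->
  exists2 k, (0 < k)%N & q ^+ k <= e.
Proof.
move=> /andP[q0 q1] e0; pose x := q^-1 - 1.
have x0 : 0 < x by rewrite subr_gt0 invf_gt1.
exists (Num.bound (e^-1 / x)).+1 => //; set k := _.+1.
have kx : e^-1 <= k%:R * x.
  rewrite -ler_pdivrMr //.
  have /archi_boundP/ltW h : 0 <= e^-1 / x by apply: divr_ge0; rewrite ?invr_ge0; exact: ltW.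
  by apply: le_trans h _; rewrite ler_nat.
have := @bernoulli_ineq x k ltac:(lra).
have -> : 1 + x = q^-1 by rewrite /x; ring.
have qk : 0 < q ^+ k by apply: exprn_gt0.
rewrite exprVn => h; rewrite -[leLHS]invrK -[leRHS]invrK.
by rewrite lef_pV2 ?posrE ?invr_gt0 //; lra.
Qed.

Lemma nrm_sqrE (z : C) : nrm z ^+ 2 = complex.Re z ^+ 2 + complex.Im z ^+ 2.
Proof. by case: z => a b; rewrite /= sqr_sqrtr ?addr_ge0 ?sqr_ge0. Qed.

Lemma geometric_quotient (x : C) k : x != 1 ->
  \sum_(i < k) x ^+ (k - i) = x * (1 - x ^+ k) / (1 - x).
Proof.
move=> x1; rewrite (reindex_inj rev_ord_inj) /=.
have -> : \sum_(j < k) x ^+ (k - (k - j.+1)) = x * \sum_(j < k) x ^+ j.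
  by rewrite mulr_sumr; apply: eq_bigr => j _; rewrite -exprS subKn.
have nz : 1 - x != 0 by rewrite subr_eq0 eq_sym.
apply: (mulIf nz); rewrite divfK // -mulrA; congr (_ * _).
by rewrite -[1 - x]opprB -[1 - x ^+ k]opprB subrX1; ring.
Qed.

(* The polynomial w^k (1 + eta (x + ... + x^k)) with x = 1 / (b z0 w). At
   w = 1 / (z0 z) this gives x = z / b, and the second factor approximates
   (b - (1 - eta) z) / (b - z), whose modulus is less than 1 when b > 1 and z
   lies near the unit circle but away from 1. *)
Definition arc_poly (k : nat) (eta b : R) (z0 : C) : {poly C} :=
  'X^k + \poly_(i < k) (eta%:C%C / (b%:C%C * z0) ^+ (k - i)).

Lemma arc_poly_size k eta b z0 : size (arc_poly k eta b z0) = k.+1.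
Proof. by rewrite size_polyDl size_polyXn // ltnS size_poly. Qed.

Lemma arc_poly_monic k eta b z0 : arc_poly k eta b z0 \is monic.
Proof.
by rewrite monicE lead_coefDl ?lead_coefXn // size_polyXn ltnS size_poly.
Qed.

Lemma arc_polyE k eta b z0 (z : C) : b != 0 -> z0 != 0 -> z != 0 ->
  (arc_poly k eta b z0).[(z0 * z)^-1] =
  (z0 * z)^-1 ^+ k * (1 + eta%:C%C * \sum_(i < k) (z / b%:C%C) ^+ (k - i)).
Proof.
move=> b0 z00 z0'; rewrite hornerD hornerXn horner_poly mulrDr mulr1; congr (_ + _).
rewrite !mulr_sumr; apply: eq_bigr => i _.
have b0' : b%:C%C != 0 :> C by rewrite fmorph_eq0.
have w0 : (z0 * z)^-1 != 0 by rewrite invr_eq0 mulf_neq0.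
rewrite -[in (_ ^+ k)](subnKC (ltnW (ltn_ord i))) exprD.
rewrite mulrC -!mulrA; congr (_ * _); rewrite mulrCA; congr (_ * _).
by rewrite -exprMn -exprVn; congr (_ ^+ _); field; rewrite z0' z00 b0'.
Qed.

(* On the part of the contour bulging out of the unit disc. *)
Lemma arc_poly_far k eta b z0 (z : C) (u : R) : (0 < k)%N -> 0 <= eta -> 1 <= b ->
    nrm z0 = 1 -> 0 < u <= 1 -> 1 + u / 8 <= nrm z -> eta * k%:R <= u / 32 ->
  nrm (arc_poly k eta b z0).[(z0 * z)^-1] <= 1 - u / 32.
Proof.
move=> k0 eta0 b1 nz0 /andP[u0 u1] nz ek.
have nw : nrm (z0 * z)^-1 <= 1 - u / 16.
  rewrite nrmV nrmM nz0 mul1r -[leRHS]invrK lef_pV2 ?posrE ?invr_gt0; [|lra|lra].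
  by apply: le_trans nz; rewrite -div1r ler_pdivrMr; [nra|lra].
set w := (z0 * z)^-1 in nw *.
have nw1 : nrm w <= 1 by lra.
rewrite hornerD hornerXn horner_poly.
apply: le_trans (nrmD _ _) _.
have h1 : nrm (w ^+ k) <= 1 - u / 16.
  rewrite nrmX -(prednK k0) exprS -[leRHS]mulr1; apply: ler_pM => //.
  + exact: nrm_ge0.
  + by rewrite exprn_ge0 // nrm_ge0.
  by rewrite exprn_ile1 ?nrm_ge0.
suff : nrm (\sum_(i < k) eta%:C%C / (b%:C%C * z0) ^+ (k - i) * w ^+ i) <= eta * k%:R.
  by lra.
apply: le_trans (nrm_sum _ _ _) _.
rewrite mulr_natr -[X in eta *+ X]card_ord -sumr_const; apply: ler_sum => i _.
rewrite !nrmM nrmV !nrmX nrmM nrm_real nz0 mulr1 nrm_real (ger0_norm eta0).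
rewrite ger0_norm; last by lra.
rewrite -mulrA ler_piMr // -[leRHS]mulr1; apply: ler_pM.
+ by rewrite invr_ge0 exprn_ge0 //; lra.
+ by rewrite exprn_ge0 // nrm_ge0.
+ by rewrite invf_le1 ?exprn_ege1 // exprn_gt0 //; lra.
by rewrite exprn_ile1 ?nrm_ge0.
Qed.

Lemma nrm_le_sqr (z : C) (m : R) : 0 <= m -> nrm z ^+ 2 <= m ^+ 2 -> nrm z <= m.
Proof. by move=> m0; rewrite ler_pXn2r ?nnegrE ?nrm_ge0. Qed.

Lemma near_gap (r bc eta u : R) : 0 < u <= 1 -> 0 < eta <= u / 24 ->
    1 - u / 12 <= r <= 1 + u / 4 -> bc <= 1 - u / 6 ->
  u / 24 <= r * (2 * (r - bc) - eta * r).
Proof.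
move=> /andP[u0 u1] /andP[e0 e1] /andP[r0 r1] hbc.
have er : eta * r <= u / 24 * 2 by apply: ler_pM; lra.
have h : u / 12 <= 2 * (r - bc) - eta * r by lra.
apply: (@le_trans _ _ (2^-1 * (u / 12))); first by lra.
by apply: ler_pM; lra.
Qed.

(** The constant 432 is 2 * 9 * 24: the gap x / 24 is at least (x / 216) N because N <= 9, and
    taking the square root halves x / 216. *)
Lemma near_ratio_sqr (N D x : R) : 0 <= N <= 9 -> 0 <= x ->
  D <= N - x / 24 -> D <= (1 - x / 432) ^+ 2 * N.
Proof.
move=> /andP[N0 N9] x0 h; have : x * N <= x * 9 by apply: ler_wpM2l.
have := mulr_ge0 (sqr_ge0 x) N0; lra.
Qed.

(** Expanding, |b - z|^2 - |b - (1 - eta) z|^2 = eta r (2 (r - b cos t) - eta r). This is positive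
    because away from the direction of 1 the number b cos t stays below r, even for r slightly less
    than 1. *)
Lemma near_ratio (b r t eta u : R) (z := r%:C%C * expi t : C) :
    0 < eta <= u / 24 -> b = 1 + u / 3 -> 0 < u <= 1 ->
    1 - u / 12 <= r <= 1 + u / 4 -> cos t <= 1 - u / 2 ->
    nrm (b%:C%C - z) <= 3 ->
  nrm (b%:C%C - (1 - eta)%:C%C * z) <= (1 - eta * u / 432) * nrm (b%:C%C - z).
Proof.
move=> eta1 bE u1 r1 ct N3.
have xx : 0 <= eta * u <= 1.
  move/andP: eta1 u1 => [e0 e1] /andP[u0 u1]; apply/andP; split.
    by apply: mulr_ge0; lra.
  by rewrite -[leRHS]mulr1; apply: ler_pM; lra.
apply: nrm_le_sqr; first by apply: mulr_ge0; [lra|exact: nrm_ge0].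
rewrite exprMn.
have N9 : nrm (b%:C%C - z) ^+ 2 <= 3 ^+ 2.
  by rewrite ler_pXn2r ?nnegrE ?nrm_ge0.
have sE : sin t ^+ 2 = 1 - cos t ^+ 2 by rewrite -(cos2Dsin2 t) addrC addKr.
have zE : z = (r * cos t +i* (r * sin t))%C.
  by rewrite /z /expi /real_complex_def; simpc.
have e1 : nrm (b%:C%C - z) ^+ 2 = (b - r * cos t) ^+ 2 + (r * sin t) ^+ 2.
  by rewrite nrm_sqrE zE /real_complex_def; simpc; rewrite /= sqrrN.
have e2 : nrm (b%:C%C - (1 - eta)%:C%C * z) ^+ 2 =
    (b - (1 - eta) * (r * cos t)) ^+ 2 + ((1 - eta) * (r * sin t)) ^+ 2.
  by rewrite nrm_sqrE zE /real_complex_def; simpc; rewrite /= sqrrN.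
rewrite e2; move: e1 N9; set N := nrm _ ^+ 2 => e1 N9.
apply: near_ratio_sqr; [by rewrite sqr_ge0; lra|lra|].
have key : u / 24 <= r * (2 * (r - b * cos t) - eta * r).
  apply: near_gap => //; move/andP: u1 => [u0 u1].
  apply: (@le_trans _ _ (b * (1 - u / 2))); first by apply: ler_wpM2l => //; lra.
  by rewrite bE; have := sqr_ge0 u; lra.
have -> : (b - (1 - eta) * (r * cos t)) ^+ 2 + ((1 - eta) * (r * sin t)) ^+ 2 =
   N - eta * (r * (2 * (r - b * cos t) - eta * r)).
  rewrite e1 !exprMn sE; ring.
by rewrite lerD2l lerN2 -mulrA ler_wpM2l //; lra.
Qed.

(** The cost of truncating the geometric series of ratio z / b in [arc_poly], with [y] standing for
    |b - z|. The ratio is at most q < 1 in modulus, so a large [k] makes the cost negligible against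
    the gain of [near_ratio]. *)
Lemma near_tail (b r eta u q : R) k (y : R) : 0 < eta -> 0 < u <= 1 ->
    b = 1 + u / 3 -> q = (1 + u / 4) / (1 + u / 3) ->
    24 / u * q ^+ k <= u / 864 -> 0 <= r <= 1 + u / 4 -> u / 12 <= y ->
  eta * r * (r / b) ^+ k / y <= eta * u / 864.
Proof.
move=> eta0 /andP[u0 u1] bE qE kbig /andP[r0 r1] hy.
have h : (r / b) ^+ k <= q ^+ k.
  rewrite lerXn2r ?nnegrE ?divr_ge0 //; try lra.
    by rewrite qE divr_ge0; lra.
  by rewrite qE bE ler_pM2r ?invr_gt0; lra.
have h0 : 0 <= (r / b) ^+ k by rewrite exprn_ge0 // divr_ge0; lra.
rewrite -!mulrA ler_pM2l // !mulrA; apply: le_trans kbig.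
have -> : 24 / u * q ^+ k = (2 * q ^+ k) / (u / 12) by field; lra.
apply: ler_pM; rewrite ?invr_ge0; try lra.
- by apply: mulr_ge0.
- by apply: ler_pM => //; lra.
by rewrite lef_pV2 ?posrE; lra.
Qed.

(** The cost of running inside the disc: the factor w^k of [arc_poly] may exceed 1 there, but by
    Bernoulli only slightly once [k * d] is small. *)
Lemma near_inv_expr (r d x : R) k : 0 <= x <= 1 -> 0 <= d <= 2^-1 ->
  1 - d <= r -> k%:R * d <= x / 1728 -> r^-1 ^+ k <= (1 - x / 1728)^-1.
Proof.
move=> /andP[x0 x1] /andP[d0 d1] hr kd.
have h : 1 - x / 1728 <= (1 - d) ^+ k.
  have := @bernoulli_ineq (- d) k ltac:(lra); rewrite mulrN.
  by apply: le_trans; lra.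
have r0 : 0 < r by lra.
have x2 : 0 < 1 - x / 1728 by lra.
have d2 : 0 <= 1 - d by lra.
rewrite exprVn lef_pV2 ?posrE ?exprn_gt0 //.
by apply: le_trans h _; rewrite lerXn2r // nnegrE ltW.
Qed.

(** The budget: a gain of x / 432, half of it lost to the truncation, and half of the rest to the
    factor w^k, by 1 - x / 864 <= (1 - x / 1728)^2. *)
Lemma near_combine (x p y y1 y2 : R) : 0 <= x <= 1 -> 0 <= p ->
    p <= (1 - x / 1728)^-1 -> 0 <= y -> y <= y1 + y2 -> y1 <= 1 - x / 432 ->
    y2 <= x / 864 -> p * y <= 1 - x / 1728.
Proof.
move=> /andP[x0 x1] p0 px y0 yy h1 h2.
have x2 : 0 < 1 - x / 1728 by lra.
have y3 : y <= 1 - x / 864 by lra.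
apply: le_trans (ler_pM p0 y0 px y3) _.
rewrite mulrC ler_pdivrMr //; have := sqr_ge0 x; lra.
Qed.

(* On the part of the contour away from z0, where it may run inside the unit disc. *)
Lemma arc_poly_near k eta b z0 (r t u d : R) :
    0 < eta <= u / 24 -> b = 1 + u / 3 -> nrm z0 = 1 -> 0 < u <= 1 ->
    24 / u * ((1 + u / 4) / (1 + u / 3)) ^+ k <= u / 864 ->
    0 <= d <= u / 12 -> k%:R * d <= eta * u / 1728 ->
    1 - d <= r <= 1 + u / 4 -> cos t <= 1 - u / 2 ->
  nrm (arc_poly k eta b z0).[(z0 * (r%:C%C * expi t))^-1] <= 1 - eta * u / 1728.
Proof.
move=> eta1 bE nz0 u1 + d1 + r1 ct.
have [r0 eta0 b1 u0] : [/\ 11 / 12 <= r, 0 < eta, 1 < b & 0 < u].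
  by split; lra.
have xx : 0 < eta * u <= 1.
  move/andP: eta1 u1 => [e0 e1] /andP[_ u1]; apply/andP; split.
    by apply: mulr_gt0.
  by rewrite -[leRHS]mulr1; apply: ler_pM; lra.
set z := r%:C%C * expi t.
have nz : nrm z = r by rewrite nrmM nrm_expi mulr1 nrm_real ger0_norm //; lra.
have nb : nrm (b%:C%C : C) = b by rewrite nrm_real ger0_norm //; lra.
have z_neq0 : z != 0 by rewrite -nrm_gt0 nz; lra.
have z0_neq0 : z0 != 0 by rewrite -nrm_gt0 nz0.
have bC : b%:C%C != 0 :> C by rewrite -nrm_gt0 nb; lra.
have b_neq0 : b != 0 by lra.
rewrite arc_polyE //.
have bz1 : u / 12 <= nrm (b%:C%C - z).
  by have := nrmD (b%:C%C - z) z; rewrite subrK nb nz; move: (nrm _) => y; lra.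
have bz3 : nrm (b%:C%C - z) <= 3.
  by have := nrmB b%:C%C z; rewrite nb nz; move: (nrm _) => y; lra.
have bzp : 0 < nrm (b%:C%C - z) by move: (nrm _) bz1 => y; lra.
have bz0 : b%:C%C - z != 0 by rewrite -nrm_gt0.
have x1 : z / b%:C%C != 1.
  by apply: contra bz0 => /eqP h; rewrite -[z](divfK bC) h mul1r subrr.
have ratio : nrm (b%:C%C - (1 - eta)%:C%C * z) <= (1 - eta * u / 432) * nrm (b%:C%C - z).
  by apply: near_ratio => //; lra.
have hr : 1 - d <= r by lra.
have hr0 : 0 <= r <= 1 + u / 4 by lra.
have hx : 0 <= eta * u <= 1 by lra.
have hd : 0 <= d <= 2^-1 by lra.
move=> kbig kd; clearbody z.
rewrite geometric_quotient //.
(* The first quotient is the value for the full geometric series, the second one the effect of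
   stopping at k terms. *)
have -> : 1 + eta%:C%C * (z / b%:C%C * (1 - (z / b%:C%C) ^+ k) / (1 - z / b%:C%C)) =
  (b%:C%C - (1 - eta)%:C%C * z) / (b%:C%C - z) -
  eta%:C%C * z * (z / b%:C%C) ^+ k / (b%:C%C - z).
  by rewrite rmorphB rmorph1; field; rewrite bC bz0.
rewrite nrmM nrmX nrmV nrmM nz0 nz mul1r.
have main : nrm ((b%:C%C - (1 - eta)%:C%C * z) / (b%:C%C - z)) <= 1 - eta * u / 432.
  by rewrite nrmM nrmV ler_pdivrMr.
have tail : nrm (eta%:C%C * z * (z / b%:C%C) ^+ k / (b%:C%C - z)) <= eta * u / 864.
  rewrite !nrmM !nrmV !nrmX nrmM nrmV nz nb nrm_real (ger0_norm (ltW eta0)).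
  exact: (near_tail eta0 u1 bE erefl kbig hr0 bz1).
have rk : r^-1 ^+ k <= (1 - eta * u / 1728)^-1.
  exact: near_inv_expr hx hd hr kd.
have h1 : 0 <= r^-1 ^+ k by rewrite exprn_ge0 // invr_ge0; case/andP: hr0.
exact: near_combine hx h1 rk (nrm_ge0 _) (nrmB _ _) main tail.
Qed.

End ArcPolynomial.

(** * The bulging contour and the deformation onto it *)

Section Contour.
Variable R : realType.
Local Notation C := R[i].

(** A kink is allowed, since the deformation only has to be Lipschitz. The height is 0 for
    [c <= 1 - u] and at least u / 4 for [c >= 1 - u / 2]; the latter range is where [arc_poly_near]
    does not apply and [arc_poly_far] must. *)
Definition bulge (u c : R) : R := Num.max 0 ((c - (1 - u)) / 2).

Lemma bulge_ge0 u c : 0 <= bulge u c.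
Proof. by rewrite /bulge le_max lexx. Qed.

Lemma bulge_le u c : 0 <= u -> c <= 1 -> bulge u c <= u / 2.
Proof. by move=> u0 c1; rewrite /bulge ge_max; apply/andP; split; lra. Qed.

Lemma bulge_lip u c c' : `|bulge u c - bulge u c'| <= `|c - c'|.
Proof.
have sub a a' : bulge u a - bulge u a' <= `|a - a'|.
  have h1 := ler_norm (a - a'); have h2 := normr_ge0 (a - a').
  have h3 := bulge_ge0 u a'.
  have h4 : (a' - (1 - u)) / 2 <= bulge u a' by rewrite /bulge le_max lexx orbT.
  have [h|h] : bulge u a = 0 \/ bulge u a = (a - (1 - u)) / 2.
    by rewrite /bulge; case: leP => _; [right|left].
  - by rewrite h; lra.
  - by rewrite h; lra.
by rewrite ler_norml sub andbT lerNl opprB distrC sub.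
Qed.

Definition angle (y : R) : R := 2 * pi * y.

(* x = 0 gives the circle of radius 1 - d; as x grows to 1 the arc around z0
   bulges out of the unit disc and the rest of the circle stays put. *)
Definition contour (u d : R) (z0 : C) (x y : R) : C :=
  z0 * ((1 - d + x * bulge u (cos (angle y)))%:C%C * expi (angle y)).

(** The angle moves at speed 2 pi. It acts through the radius with factor 1, and through [expi] with
    factor 2 times a radius of at most 2, in all 5 * 2 pi; the 1 accounts for [x]. *)
Definition contour_lip : R := 10 * pi + 1.

Lemma contour_lip_gt0 : 0 < contour_lip.
Proof. by rewrite /contour_lip; have := pi_ge0 R; lra. Qed.

Variables (u d : R) (z0 : C).
Hypotheses (u01 : 0 < u <= 1) (d01 : 0 <= d <= u / 12) (nz0 : nrm z0 = 1).
Local Notation gam := (contour u d z0).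

Let angleD (y y' : R) : angle (y + y') = angle y + angle y'.
Proof. by rewrite /angle mulrDr. Qed.

Let angleB (y y' : R) : angle y - angle y' = 2 * pi * (y - y').
Proof. by rewrite /angle mulrBr. Qed.

Let angle0 : angle 0 = 0. Proof. by rewrite /angle mulr0. Qed.

Let angle1 : angle 1 = pi *+ 2.
Proof. by rewrite /angle mulr1 mulr_natl. Qed.

Lemma contour_lipschitz (x y x' y' : R) :
    0 <= x <= 1 -> 0 <= y <= 1 -> 0 <= x' <= 1 -> 0 <= y' <= 1 ->
  nrm (gam x y - gam x' y') <= contour_lip * (`|x - x'| + `|y - y'|).
Proof.
move=> x01 y01 x01' y01'; have u1 := u01; have d1 := d01.
rewrite /contour -mulrBr nrmM nz0 mul1r.
set t := angle y; set t' := angle y'.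
set b := bulge u (cos t); set b' := bulge u (cos t').
have p0 := pi_ge0 R; pose D := 2 * pi * `|y - y'|.
have dt : `|t - t'| = D.
  by rewrite angleB normrM ger0_norm // mulr_ge0.
have bb : `|b - b'| <= D.
  by rewrite -dt; apply: le_trans (bulge_lip _ _ _) (cos_lip _ _).
have ee : nrm (expi t - expi t') <= 2 * D by rewrite -dt; apply: expi_lip.
have D0 : 0 <= D by rewrite -dt.
have b0 : 0 <= b <= 2^-1.
  by rewrite bulge_ge0 (le_trans (bulge_le _ _)) ?cos_le1 //; lra.
have b0' : 0 <= b' <= 2^-1.
  by rewrite bulge_ge0 (le_trans (bulge_le _ _)) ?cos_le1 //; lra.
have -> : (1 - d + x * b)%:C%C * expi t - (1 - d + x' * b')%:C%C * expi t' =
  ((x - x') * b + x' * (b - b'))%:C%C * expi t +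
  (1 - d + x' * b')%:C%C * (expi t - expi t').
  have -> : 1 - d + x * b = (x - x') * b + x' * (b - b') + (1 - d + x' * b') by ring.
  by rewrite rmorphD; ring.
apply: le_trans (nrmD _ _) _; rewrite !nrmM nrm_expi mulr1 !nrm_real.
have h1 : `|(x - x') * b + x' * (b - b')| <= `|x - x'| + D.
  apply: le_trans (ler_normD _ _) _; rewrite !normrM; apply: lerD.
    by rewrite ler_piMr // ger0_norm; lra.
  rewrite -[D]mul1r; apply: ler_pM => //.
  by rewrite ger0_norm; lra.
have h2 : `|1 - d + x' * b'| <= 2.
  have xb : 0 <= x' * b' <= 1.
    apply/andP; split; first by apply: mulr_ge0; lra.
    by rewrite -[leRHS]mulr1; apply: ler_pM; lra.
  rewrite ger0_norm; lra.
have h3 : `|1 - d + x' * b'| * nrm (expi t - expi t') <= 2 * (2 * D).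
  by apply: ler_pM => //; exact: nrm_ge0.
apply: le_trans (lerD h1 h3) _; rewrite /contour_lip.
have : 0 <= pi * `|x - x'| by rewrite mulr_ge0.
by rewrite /D; move: (normr_ge0 (y - y')); move: `|x - x'| `|y - y'| => a c; lra.
Qed.

Lemma contour_periodic (x : R) : gam x 0 = gam x 1.
Proof. by rewrite /contour angle0 angle1 expi0 expi2pi cos0 cos2pi. Qed.

Lemma contour_circle (y : R) : gam 0 y = z0 * ((1 - d)%:C%C * expi (angle y)).
Proof. by rewrite /contour mul0r addr0. Qed.

Lemma contour_still (x y : R) : cos (angle y) < 1 - u ->
  exists2 e : R, 0 < e & forall x1 x2 y', `|y' - y| < e -> gam x1 y' = gam x2 y'.
Proof.
have p0 := pi_gt0 R; move=> cy; exists ((1 - u - cos (angle y)) / (2 * pi)).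
  by rewrite divr_gt0 ?subr_gt0 // mulr_gt0.
move=> x1 x2 y'; rewrite ltr_pdivlMr ?mulr_gt0 // => yy.
suff h0 : bulge u (cos (angle y')) = 0 by rewrite /contour h0 !mulr0.
have := cos_lip (angle y') (angle y).
rewrite angleB normrM ger0_norm; last by rewrite mulr_ge0 // ltW.
move=> h.
have : cos (angle y') < 1 - u.
  have := ler_norm (cos (angle y') - cos (angle y)).
  move: h; rewrite [2 * pi * `|_|]mulrC.
  move: (cos _) (cos _) (_ * _) cy yy => c c' a cy yy; lra.
by move: (cos _) => c h2; rewrite /bulge; apply/max_idPl; lra.
Qed.

(** The square in [u <= e ^+ 2 / 32] comes from |exp (i t) - 1|^2 = 2 - 2 cos t <= 2 u on the moving
    arc. *)
Lemma contour_moving (x y e : R) : 0 <= x <= 1 -> 0 < e <= 1 -> u <= e ^+ 2 / 32 ->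
  1 - u <= cos (angle y) -> nrm (gam x y - z0) < e.
Proof.
move=> x01 e01 ue cy; have u1 := u01; have d1 := d01.
have -> : gam x y - z0 = z0 * ((- d + x * bulge u (cos (angle y)))%:C%C *
    expi (angle y) + (expi (angle y) - 1)).
  by rewrite /contour -addrA rmorphD rmorph1; ring.
rewrite nrmM nz0 mul1r; apply: le_lt_trans (nrmD _ _) _.
rewrite nrmM nrm_expi mulr1 nrm_real.
have b0 := bulge_ge0 u (cos (angle y)).
have b1 := @bulge_le u (cos (angle y)) ltac:(lra) (cos_le1 _).
set t := angle y in cy b0 b1 *.
have h1 : nrm (expi t - 1) <= e / 2.
  apply: nrm_le_sqr; first by lra.
  by rewrite nrm_expiB1; move: (cos t) cy => c cy; lra.
move: (bulge _ _) b0 b1 => b b0 b1.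
have xb : 0 <= x * b <= u / 2.
  apply/andP; split; first by apply: mulr_ge0; lra.
  by rewrite -[leRHS]mul1r; apply: ler_pM; lra.
have e2 : e ^+ 2 <= e by rewrite expr2 ler_piMl; lra.
have h2 : `|- d + x * b| <= u by rewrite ler_norml; lra.
by lra.
Qed.

(** At equally spaced points of a circle the trapezoidal sum of G dz is a multiple of the plain sum
    of G(z) z. The factor is nearly 2 pi i / 2^n, so that the mean of G(z) z plays the part of the
    integral divided by 2 pi i. *)
Lemma trap_circle (G : C -> C) n :
  \sum_(0 <= l < 2 ^ n) trap G (node gam n 0 l) (node gam n 0 l.+1) =
  (expi (angle (half_pow R n)) - (expi (angle (half_pow R n)))^-1) / 2 *
  \sum_(0 <= l < 2 ^ n) (G (node gam n 0 l) * node gam n 0 l).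
Proof.
set w := expi _; pose z l := node gam n 0 l.
have w0 : w != 0 by apply: expi_neq0.
have zS l : z l.+1 = w * z l.
  rewrite /z /node mul0r !contour_circle -natr1 mulrDl mul1r angleD expiD -/w.
  by ring.
have zE : z (2 ^ n)%N = z 0%N.
  by rewrite /z /node half_powK !mul0r contour_periodic.
have tE l : trap G (z l) (z l.+1) =
    (w - 1) / 2 * (G (z l) * z l + w^-1 * (G (z l.+1) * z l.+1)).
  by rewrite /trap !zS; field.
under eq_bigr do rewrite -/(z _) -/(z _.+1) tE.
rewrite -mulr_sumr big_split /= -mulr_sumr.
have -> : \sum_(0 <= i < 2 ^ n) G (z i.+1) * z i.+1 = \sum_(0 <= i < 2 ^ n) G (z i) * z i.
  apply/eqP; rewrite -subr_eq0 -sumrB.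
  by rewrite (telescope_sumr (fun i => G (z i) * z i)) // zE subrr.
by field.
Qed.

(** [L] is the normalized integral of G dz over the inner circle; the deformation lets a bound on
    the bulging contour control it. *)
Lemma contour_bound (G : C -> C) (L : C) (e m : R) :
    0 < e <= 1 -> u <= e ^+ 2 / 32 ->
    (forall z, nrm (z - z0) < e -> cdiff G z) ->
    (forall y, nrm (G (gam 1 y)) <= m) ->
    (forall h : R, 0 < h -> exists n0, forall n, (n0 <= n)%N ->
      nrm ((half_pow R n)%:C%C *
        \sum_(0 <= l < 2 ^ n) (G (node gam n 0 l) * node gam n 0 l) - L) <= h) ->
  nrm L <= contour_lip * m.
Proof.
move=> e01 ue dG mG avg; apply/ler_addgt0Pr => h h0.
have K0 := contour_lip_gt0.
have [n1 hn1] := avg (h / 2) ltac:(lra).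
(* Where the contour moves it stays in the disc around [z0] on which [G] is differentiable;
   elsewhere it does not depend on [x]. *)
have good_point (x y : R) : 0 <= x <= 1 -> 0 <= y <= 1 -> cdiff G (gam x y) \/
    exists2 e : R, 0 < e & forall x1 x2 y' : R, `|y' - y| < e -> gam x1 y' = gam x2 y'.
  move=> x01 _; have [c|c] := ltP (cos (angle y)) (1 - u).
    by right; apply: contour_still.
  by left; apply: dG; apply: contour_moving.
have [n2 hn2] := discrete_goursat (ltW K0) contour_lipschitz good_point h0.
pose n := (n1 + n2 + 3)%N.
have {}hn1 := hn1 n (leq_trans (leq_addr _ _) (leq_addr _ _)).
have {}hn2 := hn2 n (leq_trans (leq_addl _ _) (leq_addr _ _)).
have hp0 := half_pow_gt0 R n.
(* By periodicity the edges y = 0 and y = 1 cancel; what remains is the bulging contour minus the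
   inner circle. *)
move: hn2; rewrite /bsum big1 ?add0r => [|i _]; last first.
  rewrite /node half_powK !mul0r !contour_periodic !subrr //.
rewrite sumrB trap_circle; set w := expi _; set S := \sum_(_ <= _ < _) _ * _.
set T := \sum_(_ <= _ < _) _ => hn2.
have nw : nrm ((w - w^-1) / 2) = nrm (w ^+ 2 - 1) / 2.
  rewrite nrmM nrmV nrm_nat; congr (_ / _).
  rewrite -[RHS]mulr1 -[X in _ = _ * X](_ : nrm w^-1 = 1); last first.
    by rewrite nrmV nrm_expi invr1.
  by rewrite -nrmM; congr nrm; field; apply: expi_neq0.
have nT : nrm T <= contour_lip * m.
  apply: le_trans (nrm_sum _ _ _) _.
  have -> : contour_lip * m = \sum_(0 <= l < 2 ^ n) (m * (contour_lip * half_pow R n)).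
    rewrite sumr_const_nat subn0 -(mulr_natr _ (2 ^ n)%N) -!mulrA [half_pow _ _ * _]mulrC.
    by rewrite half_powK mulr1 mulrC.
  rewrite [leLHS]big_nat [leRHS]big_nat; apply: ler_sum => l /andP[_ hl].
  have -> : node gam n (2 ^ n) l = gam 1 (l%:R * half_pow R n).
    by rewrite /node half_powK.
  have -> : node gam n (2 ^ n) l.+1 = gam 1 (l.+1%:R * half_pow R n).
    by rewrite /node half_powK.
  apply: le_trans (nrm_trap (mG _) (mG _)) _.
  apply: ler_wpM2l; first exact: le_trans (nrm_ge0 _) (mG 0).
  apply: le_trans (contour_lipschitz _ _ _ _) _ => //; first by lra.
  - have := @grid_point01 R n l (l.+1%:R * half_pow R n) hl.
    by apply; rewrite lexx ler_pM2r // ler_nat leqnSn.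
  - by lra.
  - have := @grid_point01 R n l (l%:R * half_pow R n) hl.
    by apply; rewrite lexx ler_pM2r // ler_nat leqnSn.
  rewrite subrr normr0 add0r -mulrBl -natr1 [_ + 1]addrC addrK mul1r.
  by rewrite (ger0_norm (ltW hp0)).
have nS : nrm ((w - w^-1) / 2 * S) <= nrm T + h.
  have := nrmD ((w - w^-1) / 2 * S - T) T; rewrite subrK nrmBC; lra.
have gap := @root_of_unity_gap R n (leq_addl _ _).
rewrite (_ : pi *+ 2 * half_pow R n = angle (half_pow R n)) -/w in gap; last first.
  by rewrite /angle mulr_natl.
have avgS : 4 * nrm ((half_pow R n)%:C%C * S) <= nrm ((w - w^-1) / 2 * S).
  rewrite [leRHS]nrmM nw nrmM nrm_real (ger0_norm (ltW hp0)) mulrA.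
  apply: ler_wpM2r; first exact: nrm_ge0.
  rewrite ler_pdivlMr //; apply: (@le_trans _ _ (8 * half_pow R n)); first by lra.
  rewrite -ler_pdivlMr //; apply: le_trans gap _.
  by rewrite ler_pdivlMr // mulrAC half_powK mul1r.
have := nrmD ((half_pow R n)%:C%C * S - L) L.
have := nrm_tri ((half_pow R n)%:C%C * S) L 0.
rewrite !subr0 [nrm (L - _)]nrmBC => k1 _.
have := nrm_ge0 T => k2.
rewrite -/S in hn1; clear -k1 k2 avgS nS nT hn1 h0; lra.
Qed.

End Contour.

Section Tends.
Variable R : realType.
Local Notation C := R[i].

Definition tends (f : nat -> C) (L : C) := forall h : R, 0 < h ->
  exists n0, forall n, (n0 <= n)%N -> nrm (f n - L) <= h.

Lemma tends_scale (c : C) f L : tends f L -> tends (fun n => c * f n) (c * L).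
Proof.
move=> fL h h0; have [n0 hn] := fL (h / (nrm c + 1)) ltac:(by
  rewrite divr_gt0 // ltr_wpDl ?nrm_ge0).
exists n0 => n /hn; rewrite -mulrBr nrmM ler_pdivlMr ?ltr_wpDl ?nrm_ge0 // => k.
by apply: le_trans k; rewrite mulrDr mulr1 mulrC lerDl nrm_ge0.
Qed.

Lemma tendsD f L g M : tends f L -> tends g M ->
  tends (fun n => f n + g n) (L + M).
Proof.
move=> fL gM h h0; have h20 : 0 < h / 2 by rewrite divr_gt0.
have [n1 h1] := fL _ h20; have [n2 h2] := gM _ h20.
exists (n1 + n2)%N => n hn; rewrite opprD addrACA.
apply: le_trans (nrmD _ _) _.
have := h1 n (leq_trans (leq_addr _ _) hn).
have := h2 n (leq_trans (leq_addl _ _) hn); lra.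
Qed.

Lemma tends_sum I (r : seq I) (f : I -> nat -> C) (L : I -> C) :
  (forall i, tends (f i) (L i)) ->
  tends (fun n => \sum_(i <- r) f i n) (\sum_(i <- r) L i).
Proof.
move=> fL; elim: r => [|i r IH].
  move=> h h0; exists 0%N => n _; rewrite !big_nil subrr nrm0; exact: ltW.
rewrite big_cons; under eq_fun do rewrite big_cons.
exact: tendsD.
Qed.

End Tends.

(** * Bounds for determinants with decaying rows and columns *)

Section DetBound.
Variable R : realType.
Local Notation C := R[i].

(** Every term of the Leibniz expansion has the same bound. The number N! of terms is spread over
    the factors as the product of the [i.+1], so that it suffices to make the factors eventually
    small. *)
Lemma det_bound N (B : 'M[C]_N) (c : R) (a : nat -> R) :
    0 <= c -> (forall i, 0 <= a i) ->
    (forall i j : 'I_N, nrm (B i j) <= c * a i * a j) ->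
  nrm (\det B) <= \prod_(i < N) (i.+1%:R * c * a i ^+ 2).
Proof.
move=> c0 a0 hB; rewrite /determinant; apply: le_trans (nrm_sum _ _ _) _.
have -> : \prod_(i < N) (i.+1%:R * c * a i ^+ 2) =
    \sum_(s : 'S_N) \prod_(i < N) (c * a i ^+ 2).
  rewrite sumr_const card_Sn -mulr_natl.
  under eq_bigr do rewrite -mulrA.
  rewrite big_split /= fact_prod natr_prod big_add1 /= big_mkord //.
apply: ler_sum => s _; rewrite nrmM nrmX nrmN nrm1 expr1n mul1r nrm_prod.
have -> : \prod_(i < N) (c * a i ^+ 2) = \prod_(i < N) (c * a i * a (s i)).
  rewrite big_split /= [RHS]big_split /= [X in _ = X * _]big_split /= -mulrA.
  congr (_ * _); under eq_bigr do rewrite expr2; rewrite big_split /=.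
  by congr (_ * _); rewrite (reindex_inj (@perm_inj _ s)).
by apply: ler_prod => i _; rewrite nrm_ge0 hB.
Qed.

Lemma hankel_base_change N (A : nat -> C) (p : nat -> {poly C}) :
    (forall i, p i \is monic) -> (forall i, size (p i) = i.+1) ->
  \det (hankel A N) = \det (\matrix_(i < N, j < N)
    \sum_(k < N) \sum_(l < N) (p i)`_k * (p j)`_l * A (k + l)%N).
Proof.
move=> pm ps; pose T : 'M[C]_N := \matrix_(i, k) (p i)`_k.
have dT : \det T = 1.
  rewrite det_trig; last first.
    by apply/is_trig_mxP => i j ij; rewrite mxE nth_default // ps.
  rewrite big1 // => i _; rewrite mxE.
  by have /monicP := pm i; rewrite lead_coefE ps.
have -> : \matrix_(i, j) \sum_(k < N) \sum_(l < N) (p i)`_k * (p j)`_l * A (k + l)%N =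
    T *m hankel A N *m T^T.
  apply/matrixP => i j; rewrite !mxE exchange_big; apply: eq_bigr => l _.
  rewrite !mxE mulr_suml; apply: eq_bigr => k _; rewrite !mxE; ring.
by rewrite !det_mulmx det_tr dT mul1r mulr1.
Qed.

Lemma prod_eventually_small (y : nat -> R) i0 : (forall i, 0 <= y i) ->
    (forall i, (i0 <= i)%N -> y i <= 2^-1) ->
  exists N1, forall N, (N1 <= N)%N -> \prod_(i < N) y i < 1.
Proof.
move=> y0 ys; pose P := \prod_(i < i0) y i.
have P0 : 0 <= P by apply: prodr_ge0.
have bnd k : \prod_(i < i0 + k) y i <= P * half_pow R k.
  elim: k => [|k IH]; first by rewrite addn0 /half_pow expr0 mulr1.
  rewrite addnS big_ord_recr /= /half_pow exprSr mulrA; apply: ler_pM => //.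
  + exact: prodr_ge0.
  by apply: ys; rewrite leq_addr.
have [n0 hn0] := @half_pow_small R (P + 1)^-1 ltac:(by rewrite invr_gt0 ltr_wpDl).
exists (i0 + n0)%N => N hN; have -> : N = (i0 + (N - i0))%N by lia.
apply: le_lt_trans (bnd _) _.
have := hn0 (N - i0)%N ltac:(lia); set h := half_pow _ _ => hlt.
have h0 : 0 < h by apply: half_pow_gt0.
rewrite -ltr_pdivlMr //; apply: (@lt_trans _ _ (P + 1)); first by lra.
by rewrite div1r -[ltLHS]invrK ltf_pV2 ?posrE // invr_gt0 ltr_wpDl.
Qed.

(** With m = i %/ k, one factor rho^m absorbs [i.+1] <= k (m + 1), by Bernoulli, and the other one
    tends to 0. *)
Lemma poly_exp_decay (rho c : R) k : 0 < rho < 1 -> (0 < k)%N -> 0 <= c ->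
  exists i0, forall i, (i0 <= i)%N ->
    i.+1%:R * c * (rho ^+ (i %/ k)) ^+ 2 <= 2^-1.
Proof.
move=> r01 k0 c0; have /andP[r0 r1] := r01.
pose h := Num.min 1 (rho^-1 - 1).
have h0 : 0 < h by rewrite lt_min ltr01 subr_gt0 invf_gt1.
have b m : m.+1%:R * rho ^+ m <= h^-1.
  have hm : m.+1%:R * h <= (rho^-1) ^+ m.
    have h1 : h <= 1 by rewrite ge_min lexx.
    have h2 : h <= rho^-1 - 1 by rewrite ge_min lexx orbT.
    have := @bernoulli_ineq R (rho^-1 - 1) m ltac:(lra).
    have -> : 1 + (rho^-1 - 1) = rho^-1 by ring.
    apply: le_trans.
    rewrite -natr1 mulrDl mul1r addrC; apply: lerD => //.
    by apply: ler_wpM2l.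
  rewrite -[leRHS]mul1r ler_pdivlMr // mulrAC -ler_pdivlMr ?exprn_gt0 //.
  by rewrite div1r -exprVn.
have kR : 0 < k%:R :> R by rewrite ltr0n.
have cc : 0 < 2 * (k%:R * (c + 1) * h^-1).
  by rewrite !mulr_gt0 ?invr_gt0 // ltr_wpDl.
have [m0 _ hm0] := @expr_small R rho (2 * (k%:R * (c + 1) * h^-1))^-1 r01
  ltac:(by rewrite invr_gt0).
exists (m0 * k)%N => i hi; set m := (i %/ k)%N.
have mm : (m0 <= m)%N by rewrite leq_divRL.
have im : i.+1%:R <= k%:R * m.+1%:R :> R.
  by rewrite -natrM ler_nat mulnC ltn_ceil.
have rm : rho ^+ m <= (2 * (k%:R * (c + 1) * h^-1))^-1.
  apply: le_trans hm0; rewrite -(subnK mm) exprD.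
  apply: ler_piMl; first by rewrite exprn_ge0 // ltW.
  by apply: exprn_ile1; exact: ltW.
have rm0 : 0 < rho ^+ m by apply: exprn_gt0.
apply: (@le_trans _ _ ((k%:R * (c + 1) * (m.+1%:R * rho ^+ m)) * rho ^+ m)).
  rewrite expr2 !mulrA; apply: ler_wpM2r; first exact: ltW.
  apply: ler_wpM2r; first exact: ltW.
  rewrite [leRHS](_ : _ = (k%:R * m.+1%:R) * (c + 1)); last by ring.
  by apply: ler_pM => //; lra.
apply: (@le_trans _ _ ((k%:R * (c + 1) * h^-1) * rho ^+ m)).
  apply: ler_wpM2r; first exact: ltW.
  by apply: ler_wpM2l => //; rewrite mulr_ge0 ?ltW // ltr_wpDl.
move: cc rm; set X := _ * h^-1 => cc rm.
have X0 : 0 < X by lra.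
rewrite mulrC -ler_pdivlMr // -invfM; exact: rm.
Qed.

End DetBound.

Section HankelDecay.
Variable R : realType.
Local Notation C := R[i].

Lemma hankel_entry_bound (u d e M a b : R) (z0 : C) (G : C -> C) (A : nat -> C)
    (p q : {poly C}) (N : nat) (gam := contour u d z0) :
    0 < u <= 1 -> 0 <= d <= u / 12 -> nrm z0 = 1 -> 0 < e <= 1 ->
    u <= e ^+ 2 / 32 -> (size p <= N)%N -> (size q <= N)%N ->
    (forall k, tends (fun n => (half_pow R n)%:C%C * \sum_(0 <= l < 2 ^ n)
       (G (node gam n 0 l) * (node gam n 0 l)^-1 ^+ k)) (A k)) ->
    (forall z, nrm (z - z0) < e -> cdiff G z) ->
    (forall y, nrm (G (gam 1 y)) <= M) ->
    (forall y, nrm (gam 1 y)^-1 <= 2) ->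
    (forall y, nrm p.[(gam 1 y)^-1] <= a) ->
    (forall y, nrm q.[(gam 1 y)^-1] <= b) ->
  nrm (\sum_(k < N) \sum_(l < N) p`_k * q`_l * A (k + l)%N) <=
  contour_lip R * (2 * M * a * b).
Proof.
move=> u01 d01 nz0 e01 ue sp sq avg dG hM h2 ha hb.
(* The factor [z^-1] is that of dz / z: the means in [contour_bound] are those of [Psi z * z]. *)
pose Psi z := z^-1 * G z * p.[z^-1] * q.[z^-1].
apply: (@contour_bound _ u d z0 u01 d01 nz0 Psi _ e) => //.
- move=> z hz; have z_neq0 : z != 0.
    apply: contraTneq hz => ->; rewrite sub0r nrmN nz0 -leNgt; lra.
  have := cdiff_horner_inv p z_neq0; have := cdiff_horner_inv q z_neq0.
  move=> dq dp; apply: cdiffM => //; apply: cdiffM => //; apply: cdiffM.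
    exact: cdiff_inv.
  exact: dG.
- move=> y; rewrite /Psi !nrmM; apply: ler_pM => //; rewrite ?mulr_ge0 ?nrm_ge0 //.
  by apply: ler_pM => //; rewrite ?mulr_ge0 ?nrm_ge0 //; apply: ler_pM; rewrite ?nrm_ge0.
rewrite -/(tends _ _).
have tE : (fun n => (half_pow R n)%:C%C * \sum_(0 <= l < 2 ^ n)
      (Psi (node gam n 0 l) * node gam n 0 l)) =
    (fun n => \sum_(k < N) \sum_(l < N) (p`_k * q`_l *
      ((half_pow R n)%:C%C * \sum_(0 <= i < 2 ^ n)
         (G (node gam n 0 i) * (node gam n 0 i)^-1 ^+ (k + l))))).
  apply/funext => n.
  under [RHS]eq_bigr => k _ do under eq_bigr => l _ do rewrite mulrCA mulr_sumr.
  under [RHS]eq_bigr => k _ do rewrite -mulr_sumr.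
  rewrite -mulr_sumr; congr (_ * _).
  under [RHS]eq_bigr => k _ do rewrite exchange_big.
  rewrite exchange_big /=; apply: eq_bigr => i _; rewrite /Psi.
  set z := node _ _ _ _.
  have z_neq0 : z != 0.
    rewrite /z /node /gam mul0r contour_circle mulf_neq0 // -nrm_gt0 ?nz0 //.
    rewrite nrmM nrm_expi mulr1 nrm_real normr_gt0; lra.
  rewrite (horner_coef_wide _ sp) (horner_coef_wide _ sq).
  rewrite [LHS](_ : _ = G z * ((\sum_(i < N) p`_i * z^-1 ^+ i) *
    (\sum_(i < N) q`_i * z^-1 ^+ i))); last by field.
  rewrite big_distrlr mulr_sumr; apply: eq_bigr => k _.
  rewrite mulr_sumr; apply: eq_bigr => l _; rewrite exprD /=; ring.
rewrite tE; apply: tends_sum => k; apply: tends_sum => l; exact: tends_scale.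
Qed.

(** First [k] makes the truncation negligible, then [eta] gets [eta * k <= u / 32] for the bulging
    part, then [d] gets [k * d <= eta * u / 1728] for the inner part. Rotating by [z0] changes none
    of them. *)
Lemma arc_contour (u : R) : 0 < u <= 1 ->
  exists k d rho, [/\ (0 < k)%N, 0 < d <= u / 12, 0 < rho < 1 &
    forall z0 : C, nrm z0 = 1 -> exists p : {poly C},
      [/\ p \is monic, size p = k.+1 &
       forall y, nrm p.[(contour u d z0 1 y)^-1] <= rho]].
Proof.
move=> u01; have /andP[u0 u1] := u01.
have q01 : 0 < (1 + u / 4) / (1 + u / 3) < 1.
  by apply/andP; split; [apply: divr_gt0|rewrite ltr_pdivrMr]; lra.
have e0 : 0 < u / 864 / (24 / u).
  have p1 : 0 < 864 :> R by rewrite ltr0n.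
  have p2 : 0 < 24 :> R by rewrite ltr0n.
  exact: divr_gt0 (divr_gt0 u0 p1) (divr_gt0 p2 u0).
have [k k0 +] := expr_small q01 e0.
clear q01 e0.
have k1 : 0 < k%:R + 1 :> R by rewrite ltr_wpDl.
have kR : 1 <= k%:R :> R by rewrite ler1n.
pose eta := u / 32 / (k%:R + 1).
have eta0 : 0 < eta by apply: divr_gt0; lra.
have etak : eta * (k%:R + 1) = u / 32 by rewrite /eta divfK // gt_eqF.
have eta1 : eta <= u / 32 by rewrite -etak ler_peMr ?ltW //; lra.
have etak' : eta * k%:R <= u / 32 by rewrite -etak ler_pM2l //; lra.
pose x := eta * u; have x0 : 0 < x by apply: mulr_gt0.
have x1 : x <= eta by rewrite /x ler_piMr // ltW.
pose d := x / 1728 / (k%:R + 1).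
have d0 : 0 < d by apply: divr_gt0; lra.
have dk : d * (k%:R + 1) = x / 1728 by rewrite /d divfK // gt_eqF.
have d1 : d <= x / 1728 by rewrite -dk ler_peMr ?ltW //; lra.
have kd : k%:R * d <= x / 1728 by rewrite -dk mulrC ler_pM2l //; lra.
have eta2 : 0 < eta <= u / 24 by lra.
have d2 : 0 <= d <= u / 12 by lra.
have rho01 : 0 < 1 - x / 1728 < 1 by lra.
have d01 : 0 < d <= u / 12 by rewrite d0; case/andP: d2.
move=> hk; exists k, d, (1 - x / 1728); split; [exact: k0|exact: d01|exact: rho01|] => z0 nz0.
have t0 : 0 < 24 / u by apply: divr_gt0 u0; rewrite ltr0n.
have kbig : 24 / u * ((1 + u / 4) / (1 + u / 3)) ^+ k <= u / 864.
  move: hk t0; move: (_ ^+ k) (u / 864) (24 / u) => a b c h c0.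
  by rewrite mulrC -ler_pdivlMr.
clear hk t0.
exists (arc_poly k eta (1 + u / 3) z0).
split; [exact: arc_poly_monic|exact: arc_poly_size|] => y.
rewrite /contour mul1r; set t := angle y.
have ct1 := cos_le1 t.
have bu := bulge_ge0 u (cos t).
have [ct|ct] := leP (cos t) (1 - u / 2).
  apply: (arc_poly_near eta2 erefl nz0 u01 kbig d2 kd _ ct).
  have : bulge u (cos t) <= u / 4 by rewrite /bulge ge_max; clear -ct u0; lra.
  clear -bu d0; lra.
have b1 : u / 4 <= bulge u (cos t).
  rewrite /bulge le_max; apply/orP; right; clear -ct; lra.
apply: (@le_trans _ _ (1 - u / 32)); last by clear -x1 eta1 u0; lra.
apply: (arc_poly_far k0 (ltW eta0) _ nz0 u01 _ etak'); first by clear -u0; lra.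
rewrite nrmM nrm_expi mulr1 nrm_real.
apply: le_trans (ler_norm _); clear -b1 d1 x1 eta1 u0; lra.
Qed.

(** Cauchy's formula for the k-th Taylor coefficient, with the integral over the circle of radius r
    replaced by the mean over 2^n points. *)
Definition circle_avg (G : C -> C) (z0 : C) (r : R) (k n : nat) : C :=
  (half_pow R n)%:C%C * \sum_(0 <= l < 2 ^ n)
    (G (z0 * (r%:C%C * expi (angle (l%:R * half_pow R n)))) *
     (z0 * (r%:C%C * expi (angle (l%:R * half_pow R n))))^-1 ^+ k).

(** The order of the quantifiers matters: [r] precedes [M], because the bound of a series on the
    circle of radius r depends on r, and [N1] precedes [G], which makes the estimate uniform over a
    family of functions. *)
Theorem hankel_decay (e : R) : 0 < e <= 1 -> exists2 r : R, 0 < r < 1 &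
  forall M : R, exists N1, forall (z0 : C) (G : C -> C) (A : nat -> C),
    nrm z0 = 1 ->
    (forall k, tends (circle_avg G z0 r k) (A k)) ->
    (forall z, nrm (z - z0) < e -> cdiff G z) ->
    (forall z, nrm z = r \/ nrm (z - z0) < e -> nrm (G z) <= M) ->
  forall N, (N1 <= N)%N -> nrm (\det (hankel A N)) < 1.
Proof.
move=> e01; pose u := e ^+ 2 / 32.
have u01 : 0 < u <= 1.
  have /andP[e0 e1] := e01.
  have e2 : e ^+ 2 <= 1 by rewrite expr_le1 // ltW.
  have e3 : 0 < e ^+ 2 by apply: exprn_gt0.
  by rewrite /u; apply/andP; split; lra.
have [k [d [rho [k0 d01 rho01 arc]]]] := arc_contour u01.
have /andP[rho0 rho1] := rho01.
exists (1 - d) => [|M]; first by lra.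
pose M' := Num.max M 0; have M0 : 0 <= M' by rewrite le_max lexx orbT.
have K0 : 0 < contour_lip R := contour_lip_gt0 R.
(* The 2 bounds 1/z, and each [2 ^+ k] bounds the monomial factor of one of the two basis
   polynomials. *)
pose c := contour_lip R * (2 * M' * (2 ^+ k) * (2 ^+ k)).
have c0 : 0 <= c.
  by rewrite /c !mulr_ge0 ?exprn_ge0 // ltW.
have [i0 hi0] := poly_exp_decay rho01 k0 c0.
have y_ge0 i : 0 <= i.+1%:R * c * (rho ^+ (i %/ k)) ^+ 2.
  by apply: mulr_ge0; [apply: mulr_ge0|apply: sqr_ge0].
have [N1 hN1] := prod_eventually_small y_ge0 hi0.
exists N1 => z0 G A nz0 avg dG hM N /hN1; apply: le_lt_trans.
have [p [pm sp hp]] := arc _ nz0.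
(* Since [p] has degree [k], this is monic of degree i. *)
pose q i : {poly C} := 'X^(i %% k) * p ^+ (i %/ k).
have qm i : q i \is monic by apply: rpredM; [exact: monicXn|exact: rpredX].
have sq i : size (q i) = i.+1.
  rewrite size_monicM ?monicXn ?monic_neq0 ?monic_exp // size_polyXn.
  rewrite -(prednK (_ : 0 < size (p ^+ (i %/ k)))%N); last first.
    by rewrite size_poly_gt0 monic_neq0 ?monic_exp.
  by rewrite size_exp sp addnS /= addSn addnC mulnC -divn_eq.
have d01' : 0 <= d <= u / 12 by have /andP[/ltW -> ->] := d01.
(* A point of the bulging contour either keeps the radius 1 - d or lies within [e] of [z0]. *)
have hG y : nrm (G (contour u d z0 1 y)) <= M'.
  apply: (@le_trans _ _ M); last by rewrite le_max lexx.
  apply: hM; have [cy|cy] := ltP (cos (angle y)) (1 - u).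
    left; rewrite /contour.
    have -> : bulge u (cos (angle y)) = 0 by rewrite /bulge; apply/max_idPl; lra.
    by rewrite mulr0 addr0 !nrmM nz0 nrm_expi mulr1 mul1r nrm_real ger0_norm //; lra.
  by right; apply: contour_moving => //; rewrite ler01 lexx.
have h2 y : nrm (contour u d z0 1 y)^-1 <= 2.
  rewrite nrmV /contour !nrmM nz0 nrm_expi mulr1 !mul1r nrm_real.
  have b0 := bulge_ge0 u (cos (angle y)).
  rewrite -[leRHS]invrK lef_pV2 ?posrE ?invr_gt0 ?normr_gt0; [|lra|lra].
  by apply: le_trans (ler_norm _); lra.
have hq i y : nrm (q i).[(contour u d z0 1 y)^-1] <= 2 ^+ k * rho ^+ (i %/ k).
  rewrite /q hornerM hornerXn horner_exp nrmM !nrmX; apply: ler_pM.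
  - by rewrite exprn_ge0 // nrm_ge0.
  - by rewrite exprn_ge0 // nrm_ge0.
  - apply: (@le_trans _ _ (2 ^+ (i %% k))).
      by rewrite lerXn2r ?nnegrE ?nrm_ge0.
    by rewrite ler_weXn2l ?ler1n // ltnW // ltn_mod.
  by rewrite lerXn2r ?nnegrE ?nrm_ge0 // ltW.
rewrite (hankel_base_change _ _ qm sq).
apply: (@det_bound R N _ c (fun i => rho ^+ (i %/ k))) => //.
  by move=> i; rewrite exprn_ge0 // ltW.
move=> i j; rewrite mxE.
have -> : c * rho ^+ (i %/ k) * rho ^+ (j %/ k) = contour_lip R *
    (2 * M' * (2 ^+ k * rho ^+ (i %/ k)) * (2 ^+ k * rho ^+ (j %/ k))).
  by rewrite /c; ring.
apply: (@hankel_entry_bound u d e M' _ _ z0 G A) => //.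
- by rewrite sq ltn_ord.
- by rewrite sq ltn_ord.
move=> l; rewrite [X in tends X _](_ : _ = circle_avg G z0 (1 - d) l) //.
apply/funext => n; rewrite /circle_avg; congr (_ * _); apply: eq_bigr => s _.
by rewrite /node mul0r contour_circle.
Qed.

End HankelDecay.

(** * Restriction of a power series to a curve *)

Section Summation.
Variables (R : realType) (I : choiceType).
Local Notation C := R[i].
Implicit Types (f : I -> C) (g : I -> R) (J : {fset I}).

Lemma sum_fset_split (V : zmodType) (h : I -> V) (J0 J : {fset I}) :
  fsubset J0 J ->
  \sum_(i <- J) h i = \sum_(i <- J0) h i + \sum_(i <- fsetD J J0) h i.
Proof.
move=> /fsubsetP J0J; rewrite (big_fsetID _ (mem J0)) /=; congr (_ + _).
  rewrite (_ : [fset x | x in J & x \in J0]%fset = J0) //.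
  apply/fsetP => x; rewrite !inE /=; apply/andP/idP => [[]//|h1]; split => //.
  exact: J0J.
rewrite (_ : [fset x | x in J & x \notin J0]%fset = (J `\` J0)%fset) //.
by apply/fsetP => x; rewrite !inE /= andbC.
Qed.

Lemma summable_tail g (B : R) :
    (forall J, \sum_(i <- J) g i <= B) ->
  forall e : R, 0 < e -> exists J0, forall J, fsubset J0 J ->
    \sum_(i <- fsetD J J0) g i <= e.
Proof.
move=> gB e e0; pose S := [set \sum_(i <- J) g i | J in [set: {fset I}]].
have hS : has_sup S.
  split; first by exists (\sum_(i <- fset0) g i), fset0.
  by exists B => _ [J _ <-].
have [_ [J0 _ <-] hJ0] := sup_adherent e0 hS.
exists J0 => J J0J; have : \sum_(i <- J) g i <= sup S.
  by apply: sup_upper_bound => //; exists J.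
rewrite (sum_fset_split _ J0J); lra.
Qed.

Lemma nrm_le_ReIm (z : C) : nrm z <= `|complex.Re z| + `|complex.Im z|.
Proof.
case: z => a b /=; rewrite -(@ler_pXn2r _ 2) ?nnegrE ?sqrtr_ge0 ?addr_ge0 //.
rewrite sqr_sqrtr ?addr_ge0 ?sqr_ge0 // sqrrD !real_normK ?num_real //.
by rewrite -addrA lerD2l lerDr mulrn_wge0 // mulr_ge0.
Qed.

Lemma Re_le_nrm (z : C) : `|complex.Re z| <= nrm z.
Proof.
case: z => a b /=; rewrite -sqrtr_sqr ler_sqrt ?addr_ge0 ?sqr_ge0 //.
by rewrite lerDl sqr_ge0.
Qed.

Lemma Im_le_nrm (z : C) : `|complex.Im z| <= nrm z.
Proof.
case: z => a b /=; rewrite -sqrtr_sqr ler_sqrt ?addr_ge0 ?sqr_ge0 //.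
by rewrite lerDr sqr_ge0.
Qed.

Lemma partial_sumE (V : zmodType) (h : I -> V) J :
  summability.partial_sum h J = \sum_(i <- J) h i.
Proof. by rewrite /summability.partial_sum big_seq_fsetE. Qed.

Lemma real_net_cvg (h : I -> R) :
    (forall e : R, 0 < e -> exists J0, forall J, fsubset J0 J ->
       `|\sum_(i <- J) h i - \sum_(i <- J0) h i| <= e) ->
  exists L : R, forall e : R, 0 < e -> exists J0, forall J, fsubset J0 J ->
    `|L - \sum_(i <- J) h i| <= e.
Proof.
move=> hc; pose F := summability.partial_sum h @ summability.totally.
have FF : ProperFilter F by apply: fmap_proper_filter; exact: summability.totally_filter.
have cF : cvg F.
  apply: cauchy_cvg; apply/cauchy_ballP => e e0.
  have [J0 hJ0] := hc (e / 3) ltac:(lra).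
  have nF : F [set x | `|x - \sum_(i <- J0) h i| <= e / 3].
    exists J0 => // J /= J0J; rewrite partial_sumE; exact: hJ0.
  exists ([set x | `|x - \sum_(i <- J0) h i| <= e / 3],
          [set x | `|x - \sum_(i <- J0) h i| <= e / 3]) => //= -[x y] /= [hx hy].
  rewrite /ball /= -[x - y](subrKA (\sum_(i <- J0) h i)).
  apply: le_lt_trans (ler_normD _ _) _.
  rewrite [X in _ + X]distrC; lra.
exists (lim F) => e e0.
have cl : F --> lim F by exact: cF.
move/cvgrPdist_le: cl => /(_ (@summability.totally_filter I) e e0) [J0 _ hJ0].
by exists J0 => J J0J; have := hJ0 J J0J; rewrite partial_sumE.
Qed.

Lemma complex_net_cvg f (g : I -> R) (B : R) :
    (forall i, nrm (f i) <= g i) -> (forall J, \sum_(i <- J) g i <= B) ->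
  exists L : C, forall e : R, 0 < e -> exists J0, forall J, fsubset J0 J ->
    nrm (L - \sum_(i <- J) f i) <= e.
Proof.
move=> fg gB; have tail := summable_tail gB.
have ReD (J : {fset I}) : complex.Re (\sum_(i <- J) f i) = \sum_(i <- J) complex.Re (f i).
  by rewrite (big_morph (@complex.Re R) (id1 := 0) (op1 := +%R)) // => -[? ?] [].
have ImD (J : {fset I}) : complex.Im (\sum_(i <- J) f i) = \sum_(i <- J) complex.Im (f i).
  by rewrite (big_morph (@complex.Im R) (id1 := 0) (op1 := +%R)) // => -[? ?] [].
have cau (p : C -> R) : (forall z, `|p z| <= nrm z) ->
    exists L : R, forall e : R, 0 < e -> exists J0, forall J, fsubset J0 J ->
    `|L - \sum_(i <- J) p (f i)| <= e.
  move=> pz; apply: real_net_cvg => e /tail[J0 hJ0]; exists J0 => J J0J.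
  rewrite (sum_fset_split _ J0J) addrC addKr.
  apply: le_trans (ler_norm_sum _ _ _) _; apply: le_trans (hJ0 _ J0J).
  by apply: ler_sum => i _; apply: le_trans (pz _) (fg i).
have [L1 h1] := cau _ Re_le_nrm; have [L2 h2] := cau _ Im_le_nrm.
exists (L1 +i* L2)%C => e e0.
have [J1 hJ1] := h1 (e / 2) ltac:(lra); have [J2 hJ2] := h2 (e / 2) ltac:(lra).
exists (fsetU J1 J2) => J; rewrite fsubUset => /andP[/hJ1 k1 /hJ2 k2].
apply: le_trans (nrm_le_ReIm _) _.
have -> : complex.Re ((L1 +i* L2)%C - \sum_(i <- J) f i) = L1 - \sum_(i <- J) complex.Re (f i).
  by rewrite -ReD; case: (\sum_(i <- J) f i).
have -> : complex.Im ((L1 +i* L2)%C - \sum_(i <- J) f i) = L2 - \sum_(i <- J) complex.Im (f i).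
  by rewrite -ImD; case: (\sum_(i <- J) f i).
lra.
Qed.

Lemma sum_eqP f (L : C) :
    (forall e : R, 0 < e -> exists J0, forall J, fsubset J0 J ->
       nrm (L - \sum_(i <- J) f i) <= e) ->
  summability.sum f = L.
Proof.
move=> hL; rewrite /summability.sum.
have FF := @summability.totally_filter I.
apply/cvg_lim; first exact: norm_hausdorff.
apply/cvgrPdist_le => e e0.
have eE : e = (complex.Re e)%:C%C.
  by move: e0; case: e => a b; rewrite ltcE /= => /andP[/eqP -> _].
have e0' : 0 < complex.Re e by rewrite eE ltcR in e0.
have [J0 hJ0] := hL _ e0'.
exists J0 => // J /= J0J; have := hJ0 J J0J.
by rewrite -lecR -normC_nrm -eE partial_sumE.
Qed.

(** [J0] depends on the majorant [g] alone, so one finite set approximates the sums of all families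
    dominated by [g], in particular of the series at all points of a circle. *)
Lemma sum_approx f (g : I -> R) (B : R) J0 (e : R) :
    (forall i, nrm (f i) <= g i) -> (forall J, \sum_(i <- J) g i <= B) ->
    (forall J, fsubset J0 J -> \sum_(i <- fsetD J J0) g i <= e) ->
  forall J, fsubset J0 J -> nrm (summability.sum f - \sum_(i <- J) f i) <= e.
Proof.
move=> fg gB tail J J0J; have [L hL] := complex_net_cvg fg gB.
rewrite (sum_eqP hL); apply/ler_addgt0Pr => h h0.
have [J1 hJ1] := hL h h0.
have := hJ1 (fsetU J J1) (fsubsetUr _ _).
have JJ : fsubset J (fsetU J J1) by apply: fsubsetUl.
rewrite (sum_fset_split _ JJ) opprD addrA => k1.
set X := L - _ in k1 *; set Y := \sum_(i <- _) _ in k1.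
have := nrmD (X - Y) Y; rewrite subrK => k2.
suff : nrm Y <= e by lra.
apply: le_trans (nrm_sum _ _ _) _.
apply: (@le_trans _ _ (\sum_(i <- fsetD (fsetU J J1) J) g i)).
  by apply: ler_sum.
apply: le_trans (tail (fsetU J J1) (fsubset_trans J0J JJ)).
have s : fsubset (fsetD (fsetU J J1) J) (fsetD (fsetU J J1) J0).
  exact: fsetDS.
rewrite (sum_fset_split _ s) lerDl; apply: sumr_ge0 => i _.
exact: le_trans (nrm_ge0 _) (fg i).
Qed.

Lemma nrm_sum_le f (g : I -> R) (B : R) :
    (forall i, nrm (f i) <= g i) -> (forall J, \sum_(i <- J) g i <= B) ->
  nrm (summability.sum f) <= B.
Proof.
move=> fg gB; have h := @sum_approx f g B fset0 B fg gB _ fset0 (fsubset_refl _).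
have := h (fun J _ => gB _).
by rewrite big_seq_fset0 subr0.
Qed.

End Summation.

(** * Convergence in the open unit polydisc *)

Section Domain.
Variables (R : realType) (n : nat) (a : powser n).
Local Notation C := R[i].
Implicit Types (z w : 'rV[R[i]]_n) (k : multinom n).

Lemma abs_convergentP z : abs_convergent a z <->
  exists B : R, forall J : {fset multinom n}, \sum_(k <- J) nrm (psterm a z k) <= B.
Proof.
rewrite /abs_convergent /esum.summable; split => [h|[B hB]].
  have [B hB] : exists B : R, esum.esum [set: multinom n]
      (fun k => `|(nrm (psterm a z k))%:E|%E) = B%:E.
    move: h; set s := esum.esum _ _; have : (0 <= s)%E by apply: esum.esum_ge0.
    by case: s => // B _ _; exists B.
  exists B => J; rewrite -lee_fin -hB; apply: esum.esum_ge.
  exists [set` J]; first by split => //; exact: finite_fset.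
  rewrite fsbig_finite /=; last exact: finite_fset.
  rewrite set_fsetK.
  rewrite -sumEFin; apply: lee_sum => k _.
  by rewrite lee_fin ler_norm.
apply: (@le_lt_trans _ _ B%:E); last exact: ltry.
apply: ge_ereal_sup => _ [A [fA _] <-].
rewrite fsbig_finite //= (eq_bigr (fun k => (nrm (psterm a z k))%:E)) => [|k _].
  by rewrite sumEFin lee_fin.
by rewrite ger0_norm ?nrm_ge0.
Qed.

(** Convergence on the closed polydisc of radius r, stated on the coefficients so that one majorant
    serves all its points. *)
Definition coef_bounded (r B : R) := forall J : {fset multinom n},
  \sum_(k <- J) `|a k|%:~R * r ^+ mdeg k <= B.

Lemma nrm_psterm z k : nrm (psterm a z k) =
  `|a k|%:~R * \prod_(j < n) nrm (z 0 j) ^+ k j.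
Proof.
rewrite /psterm nrmM nrm_int nrm_prod; congr (_ * _).
by apply: eq_bigr => j _; rewrite nrmX.
Qed.

Lemma prod_mdeg (r : R) k : \prod_(j < n) r ^+ k j = r ^+ mdeg k.
Proof. by rewrite mdegE; apply/esym/(big_morph _ (exprD r) (expr0 r)). Qed.

Lemma nrm_psterm_le (r : R) z k : 0 <= r -> (forall j, nrm (z 0 j) <= r) ->
  nrm (psterm a z k) <= `|a k|%:~R * r ^+ mdeg k.
Proof.
move=> r0 zr; rewrite nrm_psterm -prod_mdeg; apply: ler_wpM2l => //.
apply: ler_prod => j _; rewrite exprn_ge0 ?nrm_ge0 //=.
by rewrite lerXn2r ?nnegrE ?nrm_ge0.
Qed.

Lemma nrm_psterm_ge (r : R) z k : 0 <= r -> (forall j, r <= nrm (z 0 j)) ->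
  `|a k|%:~R * r ^+ mdeg k <= nrm (psterm a z k).
Proof.
move=> r0 zr; rewrite nrm_psterm -prod_mdeg; apply: ler_wpM2l => //.
apply: ler_prod => j _; rewrite exprn_ge0 //=.
by rewrite lerXn2r ?nnegrE ?nrm_ge0.
Qed.

Lemma ball_rvE (z w : 'rV[R[i]]_n) (e : R) : 0 < e ->
  ball z e%:C%C w <-> forall j, nrm (z 0 j - w 0 j) < e.
Proof.
move=> e0; rewrite /ball /= /mx_ball; split => [[_ h]|h].
  by move=> j; have := h 0 j; rewrite /ball /= normC_nrm ltcR.
split => [|i j]; first by rewrite ltcR.
by rewrite ord1 /ball /= normC_nrm ltcR; exact: h.
Qed.

Lemma nbhs_rvP (z : 'rV[R[i]]_n) (A : set 'rV[R[i]]_n) : nbhs z A <->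
  exists2 e : R, 0 < e & forall w, (forall j, nrm (z 0 j - w 0 j) < e) -> A w.
Proof.
split => [/nbhs_ballP[e /= e0 h]|[e e0 h]].
  have eE : e = (complex.Re e)%:C%C.
    by move: e0; case: e {h} => x y; rewrite ltcE /= => /andP[/eqP -> _].
  have e0' : 0 < complex.Re e by rewrite eE ltcR in e0.
  exists (complex.Re e) => // w hw.
  by apply: h; rewrite eE; apply/ball_rvE.
apply/nbhs_ballP; exists e%:C%C => /=; first by rewrite ltcR.
by move=> w /(ball_rvE _ _ e0); exact: h.
Qed.

Hypothesis hT : @torus R n `<=` boundary (@convergence_domain R n a).

(** The point (1, ..., 1) of the torus is adherent to the convergence domain, which therefore
    contains a point with all coordinates of modulus at least r. *)
Lemma torus_coef_bounded (r : R) : 0 < r < 1 -> exists B, coef_bounded r B.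
Proof.
move=> r01; have /hT[hcl _] : @torus R n (const_mx 1).
  by move=> j; rewrite mxE normr1.
have nb : nbhs (const_mx 1 : 'rV[R[i]]_n) [set w | forall j, r <= nrm (w 0 j)].
  apply/nbhs_rvP; exists (1 - r); first by lra.
  move=> w hw j; have := hw j; rewrite mxE => h.
  have := nrmD (1 - w 0 j) (w 0 j); rewrite subrK nrm1; lra.
have [w [/interior_subset /= /abs_convergentP[B hB] /= hw]] := hcl _ nb.
exists B => J; apply: le_trans (hB J); apply: ler_sum => k _.
by apply: nrm_psterm_ge => //; lra.
Qed.

Lemma bounded_abs_convergent (r B : R) z : 0 <= r -> coef_bounded r B ->
  (forall j, nrm (z 0 j) <= r) -> abs_convergent a z.
Proof.
move=> r0 hB zr; apply/abs_convergentP; exists B => J.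
by apply: le_trans (hB J); apply: ler_sum => k _; exact: nrm_psterm_le.
Qed.

Lemma polydisc_convergence_domain z :
  (forall j, nrm (z 0 j) < 1) -> convergence_domain a z.
Proof.
move=> hz; have [r r01 zr] : exists2 r : R, 0 < r < 1 & forall j, nrm (z 0 j) < r.
  pose m := \big[Num.max/0]_(j < n) nrm (z 0 j).
  have m1 : m < 1 by apply/bigmax_ltP; split => // j _; exact: hz.
  have m0 : 0 <= m by apply: bigmax_ge_id.
  exists ((m + 1) / 2) => [|j]; first by lra.
  have : nrm (z 0 j) <= m by apply: le_bigmax.
  lra.
have [B hB] := torus_coef_bounded r01.
apply/nbhs_rvP; pose m := \big[Num.max/0]_(j < n) nrm (z 0 j).
have mr : m < r by apply/bigmax_ltP; split => [|j _]; [lra|exact: zr].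
exists (r - m); first by lra.
move=> w hw /=; apply: (@bounded_abs_convergent r B) => //; first by lra.
move=> j; have : nrm (z 0 j) <= m by apply: le_bigmax.
have := hw j; have := nrmD (w 0 j - z 0 j) (z 0 j); rewrite subrK nrmBC; lra.
Qed.

End Domain.

Section Weight.
Variables (n : nat) (m : 'I_n -> nat).

Definition weight (j : multinom n.+1) : nat :=
  (j ord0 + \sum_(i < n) m i * j (lift ord0 i))%N.

(** Positivity of the [m i] leaves finitely many monomials of each weight, so that the coefficients
    along the curve are finite sums. *)
Lemma mdeg_weight j : (forall i, 0 < m i)%N -> (mdeg j <= weight j)%N.
Proof.
move=> m0; rewrite mdegE big_ord_recl leq_add2l; apply: leq_sum => i _.
exact: leq_pmull.
Qed.

End Weight.

Section CurveSeries.
Variables (R : realType) (n : nat) (a : powser n.+1) (m : 'I_n -> nat).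
Hypothesis m_gt0 : forall i, (0 < m i)%N.
Local Notation C := R[i].
Implicit Types (th : 'I_n -> R) (w : R[i]).

Definition phase th (j : multinom n.+1) : C :=
  \prod_(i < n) expi (th i) ^+ j (lift ord0 i).

Lemma nrm_phase th j : nrm (phase th j) = 1.
Proof.
rewrite /phase nrm_prod big1 // => i _.
by rewrite nrmX nrm_expi expr1n.
Qed.

Lemma curve_point0 th w : (curve_point m th w) 0 ord0 = w.
Proof. by rewrite mxE unlift_none. Qed.

Lemma curve_pointS th w i :
  (curve_point m th w) 0 (lift ord0 i) = expi (th i) * w ^+ m i.
Proof. by rewrite mxE liftK. Qed.

Lemma nrm_curve_point th w j : nrm w <= 1 -> nrm ((curve_point m th w) 0 j) <= nrm w.
Proof.
move=> w1; have [i ->|->] := unliftP ord0 j; last by rewrite curve_point0.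
rewrite curve_pointS nrmM nrm_expi mul1r nrmX -(prednK (m_gt0 i)) exprS.
by rewrite ler_piMr ?nrm_ge0 // exprn_ile1 ?nrm_ge0.
Qed.

Lemma curve_monomial th w (j : multinom n.+1) :
  \prod_(i < n.+1) (curve_point m th w) 0 i ^+ j i = phase th j * w ^+ weight m j.
Proof.
rewrite big_ord_recl curve_point0 /phase /weight.
under eq_bigr do rewrite curve_pointS exprMn.
rewrite big_split /= exprD mulrCA; congr (_ * (_ * _)).
rewrite (big_morph _ (exprD w) (expr0 w)).
by apply: eq_bigr => i _; rewrite exprM.
Qed.

Lemma psterm_curve th w j : psterm a (curve_point m th w) j =
  (a j)%:~R * phase th j * w ^+ weight m j.
Proof. by rewrite /psterm curve_monomial mulrA. Qed.

(** The bound [k.+1] on the degree loses nothing: a multi-index of weight k has degree at most k by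
    [mdeg_weight]. *)
Definition curve_coef th (k : nat) : C :=
  \sum_(j : bmultinom n.+1 k.+1 | weight m j == k) (a j)%:~R * phase th j.

Lemma curve_coef_fset th k (J : {fset multinom n.+1}) :
    (forall j, weight m j = k -> j \in J) ->
  \sum_(j <- J | weight m j == k) (a j)%:~R * phase th j = curve_coef th k.
Proof.
move=> hJ; rewrite /curve_coef.
rewrite -(big_map (fun j : bmultinom n.+1 k.+1 => (j : multinom n.+1))
  (fun j => weight m j == k) (fun j => (a j)%:~R * phase th j)).
rewrite -[LHS]big_filter -[RHS]big_filter; apply: perm_big; apply: uniq_perm.
- by rewrite filter_uniq // fset_uniq.
- rewrite filter_uniq // map_inj_uniq ?index_enum_uniq //.
  by move=> x y /eqP; rewrite -bmeqP => /eqP.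
move=> j; rewrite !mem_filter; case: eqP => //= ej.
rewrite hJ //; apply/esym/mapP.
have hj : (mdeg j < k.+1)%N by rewrite ltnS -ej mdeg_weight.
by exists (BMultinom hj); rewrite // mem_index_enum.
Qed.

(** For a finite part of the series the mean is exactly the coefficient, as soon as 2^N exceeds all
    weights involved; the rest is controlled uniformly on the circle. *)
Lemma circle_avg_curve (r B : R) th (z0 : C) (G : C -> C) k :
    0 < r < 1 -> coef_bounded a r B -> nrm z0 = 1 ->
    (forall w, nrm w = r -> G w = pssum a (curve_point m th w)) ->
  tends (circle_avg G z0 r k) (curve_coef th k).
Proof.
move=> r01 aB nz0 hG h h0; have /andP[r0 r1] := r01.
have rk0 : 0 < r ^+ k by apply: exprn_gt0.
(* The factor r^k compensates the modulus r^-k of [z^-1 ^+ k] in the mean. *)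
have [J0 hJ0] := summable_tail aB (mulr_gt0 h0 rk0).
pose JB : {fset multinom n.+1} :=
  [fset (j : multinom n.+1) | j : bmultinom n.+1 k.+1 in predT]%fset.
pose J := fsetU J0 JB.
have J0J : fsubset J0 J by apply: fsubsetUl.
have Jk j : weight m j = k -> j \in J.
  move=> ej; rewrite in_fsetU; apply/orP; right.
  have hj : (mdeg j < k.+1)%N by rewrite ltnS -ej mdeg_weight.
  by apply/imfsetP; exists (BMultinom hj).
exists (\sum_(j <- J) weight m j + k)%N => N hN.
have big_e j : j \in J -> (weight m j < 2 ^ N)%N.
  move=> jJ; apply: leq_ltn_trans (ltn_expl N (isT : 1 < 2)%N).
  apply: leq_trans hN; apply: leq_trans (leq_addr _ _).
  by rewrite (big_fsetD1 _ jJ) /= leq_addr.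
have big_k : (k < 2 ^ N)%N.
  apply: leq_ltn_trans (ltn_expl N (isT : 1 < 2)%N).
  by apply: leq_trans hN; rewrite leq_addl.
pose H w := \sum_(j <- J) psterm a (curve_point m th w) j.
pose pt l : C := z0 * (r%:C%C * expi (angle (l%:R * half_pow R N))).
have npt l : nrm (pt l) = r.
  by rewrite /pt !nrmM nz0 nrm_expi mulr1 mul1r nrm_real gtr0_norm.
have [c cE'] : exists c, c = z0 * r%:C%C by eexists.
have ptE l : pt l = c * expi (pi *+ 2 * (l%:R / (2 ^ N)%:R)).
  rewrite /pt cE' mulrA; congr (_ * expi _); rewrite /angle mulr_natl; congr (_ * (_ * _)).
  by rewrite /half_pow natrX exprVn.
have cE F : circle_avg F z0 r k N =
    (half_pow R N)%:C%C * \sum_(0 <= l < 2 ^ N) F (pt l) * (pt l)^-1 ^+ k by [].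
have avgH : circle_avg H z0 r k N = curve_coef th k.
  rewrite -(curve_coef_fset _ Jk) big_mkcond cE.
  rewrite (eq_bigr (fun l => \sum_(j <- J)
    psterm a (curve_point m th (pt l)) j * (pt l)^-1 ^+ k)); last first.
    by move=> l _; rewrite /H mulr_suml.
  rewrite exchange_big mulr_sumr; apply: eq_big_seq => j jJ.
  under eq_bigr => l _ do rewrite psterm_curve ptE invfM !exprMn.
  have c0 : c != 0 by rewrite cE' -nrm_gt0 nrmM nz0 mul1r nrm_real gtr0_norm.
  rewrite big_mkord (eq_bigr (fun l : 'I__ => ((a j)%:~R * phase th j *
     (c ^+ weight m j * c^-1 ^+ k)) *
     (expi (pi *+ 2 * (l%:R / (2 ^ N)%:R)) ^+ weight m j *
      (expi (pi *+ 2 * (l%:R / (2 ^ N)%:R)))^-1 ^+ k))); last first.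
    move=> l _; move: (expi _ ^+ _) ((expi _)^-1 ^+ _) (c ^+ _) (c^-1 ^+ _).
    by move=> x1 x2 x3 x4; ring.
  rewrite -mulr_sumr root_of_unity_sum ?big_e //.
  case: eqP => [->|_]; last by rewrite !mulr0.
  rewrite -exprMn divff // expr1n mulr1 mulrCA -[RHS]mulr1; congr (_ * _).
  have := half_powK R N; rewrite mulrC => /(congr1 (real_complex R)).
  by rewrite rmorphM rmorph_nat rmorph1.
have diff l : nrm (G (pt l) - H (pt l)) <= h * r ^+ k.
  rewrite hG //; apply: (sum_approx _ aB hJ0 J0J) => j.
  apply: nrm_psterm_le; first exact: ltW.
  by move=> i; rewrite -(npt l); apply: nrm_curve_point; rewrite npt ltW.
rewrite -avgH !cE -mulrBr -sumrB nrmM nrm_real gtr0_norm ?half_pow_gt0 //.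
have -> : h = half_pow R N * \sum_(0 <= l < 2 ^ N) h.
  by rewrite sumr_const_nat subn0 -(mulr_natl h (2 ^ N)%N) mulrA
     [half_pow R N * _]mulrC half_powK mul1r.
apply: ler_wpM2l; first by rewrite ltW ?half_pow_gt0.
apply: le_trans (nrm_sum _ _ _) _; apply: ler_sum => l _.
rewrite -mulrBl nrmM nrmX nrmV npt exprVn ler_pdivrMr //.
Qed.

End CurveSeries.

(** * Holomorphic functions of several variables along a curve *)

Section RvDifferential.
Variables (R : realType) (n : nat).
Local Notation C := R[i].
Implicit Types (F : 'rV[R[i]]_n -> R[i]) (p : 'rV[R[i]]_n).

Lemma mx_norm_le_sum (v : 'rV[R[i]]_n) : `|v| <= (\sum_(j < n) nrm (v 0 j))%:C%C.
Proof.
have s0 (P : pred 'I_n) : 0 <= \sum_(j < n | P j) nrm (v 0 j).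
  by apply: sumr_ge0 => j _; exact: nrm_ge0.
rewrite -[leLHS]/(mx_norm v).
have [->|/mx_norm_neq0] := eqVneq (mx_norm v) 0; first by rewrite lecR.
move=> [[i j] /= ->]; rewrite ord1 normC_nrm lecR (bigD1 j) //= lerDl; exact: s0.
Qed.

Lemma differentiable_rvE F p : differentiable F p -> exists D : 'I_n -> C,
  forall e : R, 0 < e -> exists2 d : R, 0 < d & forall w : 'rV[R[i]]_n,
    (forall j, nrm (w 0 j - p 0 j) < d) ->
    nrm (F w - F p - \sum_(j < n) D j * (w 0 j - p 0 j)) <=
      e * \sum_(j < n) nrm (w 0 j - p 0 j).
Proof.
move=> dF; exists (fun j => 'd F p (delta_mx 0 j)) => e e0.
have /eqaddoP h := diff_locally dF.
have e0' : 0 < e%:C%C :> C by rewrite ltcR.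
have /nbhs_rvP[d d0 hd] := h _ e0'.
exists d => // w hw; have := hd (w - p).
rewrite /= => k; have {k} : `|(F \o shift p - (cst (F p) + 'd F p)) (w - p)| <=
    e%:C%C * `|w - p|.
  by apply: k => j; rewrite !mxE sub0r nrmN.
have -> : (F \o shift p - (cst (F p) + 'd F p)) (w - p) =
    F w - F p - \sum_(j < n) 'd F p (delta_mx 0 j) * (w 0 j - p 0 j).
  rewrite /= -[LHS]/(F (w - p + p) - (F p + 'd F p (w - p))) subrK opprD addrA.
  congr (_ - _); rewrite {1}[w - p]row_sum_delta linear_sum; apply: eq_bigr => j _.
  by rewrite linearZ !mxE mulrC.
rewrite -lecR -normC_nrm => /le_trans; apply.
rewrite rmorphM ler_pM2l //; apply: le_trans (mx_norm_le_sum _) _.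
by rewrite lecR; apply: ler_sum => j _; rewrite !mxE.
Qed.

Lemma continuous_rvE F p : {for p, continuous F} -> forall e : R, 0 < e ->
  exists2 d : R, 0 < d & forall w : 'rV[R[i]]_n, (forall j, nrm (p 0 j - w 0 j) < d) ->
    nrm (F w - F p) < e.
Proof.
move=> cF e e0; have e0' : 0 < e%:C%C :> C by rewrite ltcR.
have /cvgrPdist_lt h := cF.
have /nbhs_rvP[d d0 hd] := h _ e0'.
by exists d; [exact: d0|move=> w /hd; rewrite normC_nrm ltcR nrmBC].
Qed.

Lemma cdiff_comp_rv F (c : C -> 'rV[R[i]]_n) z :
    differentiable F (c z) -> (forall j, cdiff (fun w => c w 0 j) z) ->
  cdiff (fun w => F (c w)) z.
Proof.
move=> /differentiable_rvE[D hD] dc.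
have [l hl] : exists l : 'I_n -> C, forall j e, 0 < e -> exists2 d : R, 0 < d &
    forall w, nrm (w - z) < d ->
    nrm (c w 0 j - c z 0 j - l j * (w - z)) <= e * nrm (w - z).
  have [l hl] := @choice _ _ (fun j l => forall e : R, 0 < e -> exists2 d : R, 0 < d &
    forall w, nrm (w - z) < d ->
    nrm (c w 0 j - c z 0 j - l * (w - z)) <= e * nrm (w - z)) dc.
  by exists l.
have [K hK] := @choice _ _ (fun j (k : R * R) => [/\ 0 < k.1, 0 < k.2 &
    forall w, nrm (w - z) < k.2 -> nrm (c w 0 j - c z 0 j) <= k.1 * nrm (w - z)])
    (fun j => match cdiff_lip (dc j) with
      | ex_intro2 k k0 (ex_intro2 d d0 h) => ex_intro _ (k, d) (And3 k0 d0 h) end).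
pose KK := \sum_(j < n) (K j).1.
have K0 : 0 <= KK by apply: sumr_ge0 => j _; have [/ltW] := hK j.
pose DD := \sum_(j < n) nrm (D j).
have D0 : 0 <= DD by apply: sumr_ge0 => j _; apply: nrm_ge0.
exists (\sum_(j < n) D j * l j) => e e0.
have e10 : 0 < e / (2 * (KK + 1)) by apply: divr_gt0; lra.
have e20 : 0 < e / (2 * (DD + 1)) by apply: divr_gt0; lra.
have [d1 d10 h1] := hD _ e10.
have [d2 hd2] := @choice _ _ (fun j (d : R) => 0 < d /\ forall w, nrm (w - z) < d ->
    nrm (c w 0 j - c z 0 j - l j * (w - z)) <= e / (2 * (DD + 1)) * nrm (w - z))
    (fun j => match hl j _ e20 with ex_intro2 d d0 h => ex_intro _ d (conj d0 h) end).
have Kj j : (K j).1 <= KK.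
  rewrite /KK (bigD1 j) //= lerDl; apply: sumr_ge0 => i _; by have [/ltW] := hK i.
pose d := \big[Num.min/(d1 / (KK + 1))]_(j < n) Num.min (K j).2 (d2 j).
have d_gt0 : 0 < d.
  apply/bigmin_gtP; split => [|j _]; first by apply: divr_gt0; lra.
  by rewrite lt_min; have [_ -> _] := hK j; have [-> _] := hd2 j.
exists d => // w wd.
have wK j : nrm (w - z) < (K j).2.
  by apply: lt_le_trans wd _; apply: (@bigmin_inf _ _ _ _ j) => //; rewrite ge_min lexx.
have w2 j : nrm (w - z) < d2 j.
  by apply: lt_le_trans wd _; apply: (@bigmin_inf _ _ _ _ j) => //; rewrite ge_min lexx orbT.
have w1 : nrm (w - z) < d1 / (KK + 1).
  by apply: lt_le_trans wd _; apply: bigmin_le_id.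
have cK j : nrm (c w 0 j - c z 0 j) <= (K j).1 * nrm (w - z).
  by have [_ _] := hK j; apply.
have dz := nrm_ge0 (w - z).
have cd1 j : nrm (c w 0 j - c z 0 j) < d1.
  apply: le_lt_trans (cK j) _.
  apply: (@le_lt_trans _ _ (KK * nrm (w - z))); first by apply: ler_wpM2r.
  move: w1; rewrite ltr_pdivlMr; last by lra.
  by apply: le_lt_trans; rewrite mulrC; apply: ler_wpM2l => //; lra.
have {}h1 := h1 _ cd1.
have -> : F (c w) - F (c z) - (\sum_(j < n) D j * l j) * (w - z) =
    (F (c w) - F (c z) - \sum_(j < n) D j * (c w 0 j - c z 0 j)) +
    \sum_(j < n) D j * (c w 0 j - c z 0 j - l j * (w - z)).
  under [X in _ = _ + X]eq_bigr do rewrite mulrBr mulrA.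
  by rewrite sumrB -mulr_suml addrA subrK.
apply: le_trans (nrmD _ _) _.
have b1 : e / (2 * (KK + 1)) * (\sum_(j < n) nrm (c w 0 j - c z 0 j)) <=
    e / 2 * nrm (w - z).
  have -> : e / 2 * nrm (w - z) = e / (2 * (KK + 1)) * ((KK + 1) * nrm (w - z)).
    by field; lra.
  apply: ler_wpM2l; first exact: ltW.
  apply: (@le_trans _ _ (\sum_(j < n) (K j).1 * nrm (w - z))); first exact: ler_sum.
  by rewrite -mulr_suml; apply: ler_wpM2r => //; rewrite -/KK; lra.
have b2 : nrm (\sum_(j < n) D j * (c w 0 j - c z 0 j - l j * (w - z))) <=
    e / 2 * nrm (w - z).
  apply: le_trans (nrm_sum _ _ _) _.
  apply: (@le_trans _ _ (\sum_(j < n) nrm (D j) * (e / (2 * (DD + 1)) * nrm (w - z)))).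
    apply: ler_sum => j _; rewrite nrmM; apply: ler_wpM2l; first exact: nrm_ge0.
    by have [_] := hd2 j; apply.
  rewrite -mulr_suml -/DD.
  have -> : e / 2 * nrm (w - z) = (DD + 1) * (e / (2 * (DD + 1)) * nrm (w - z)).
    by field; lra.
  apply: ler_wpM2r; last by lra.
  by apply: mulr_ge0 => //; exact: ltW.
lra.
Qed.

End RvDifferential.

Section Extension.
Variables (R : realType) (n : nat) (a : powser n.+1) (m : 'I_n -> nat).
Hypothesis m_gt0 : forall i, (0 < m i)%N.
Local Notation C := R[i].
Implicit Types (th : 'I_n -> R) (w z : R[i]).

Lemma cdiff_local (G H : C -> C) z (d : R) : 0 < d ->
    (forall w, nrm (w - z) < d -> G w = H w) -> cdiff H z -> cdiff G z.
Proof.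
move=> d0 GH [l hl]; exists l => e /hl[d' d'0 hd'].
exists (Num.min d d'); first by rewrite lt_min d0.
move=> w; rewrite lt_min => /andP[wd wd'].
rewrite (GH w wd) (GH z) ?subrr ?nrm0 //; exact: hd'.
Qed.

Lemma cdiffX z k : cdiff (fun w : C => w ^+ k) z.
Proof.
elim: k => [|k IH].
  by under eq_fun do rewrite expr0; exact: cdiff_cst.
by under eq_fun do rewrite exprS; apply: cdiffM => //; exact: cdiff_id.
Qed.

Lemma cdiff_curve_point th z j : cdiff (fun w => (curve_point m th w) 0 j) z.
Proof.
have [i ->|->] := unliftP ord0 j.
  under eq_fun do rewrite curve_pointS.
  by apply: cdiffM; [exact: cdiff_cst|exact: cdiffX].
by under eq_fun do rewrite curve_point0; exact: cdiff_id.
Qed.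

Lemma nrm_exprB_le w z k : nrm w <= 2 -> nrm z <= 2 ->
  nrm (w ^+ k - z ^+ k) <= (k * 2 ^ k)%:R * nrm (w - z).
Proof.
move=> w2 z2; rewrite subrXX nrmM mulrC; apply: ler_wpM2r; first exact: nrm_ge0.
apply: le_trans (nrm_sum _ _ _) _.
rewrite natrM mulr_natl -[X in _ *+ X]card_ord -sumr_const; apply: ler_sum => i _.
rewrite nrmM !nrmX; apply: (@le_trans _ _ (2 ^+ (k.-1 - i) * 2 ^+ i)).
  by apply: ler_pM; rewrite ?exprn_ge0 ?nrm_ge0 // lerXn2r ?nnegrE ?nrm_ge0.
rewrite -exprD natrX; have ik := ltn_ord i.
by apply: ler_weXn2l; [rewrite ler1n|rewrite subnK; lia].
Qed.

Lemma curve_point_continuous th0 (z0 : C) (e : R) : nrm z0 = 1 -> 0 < e ->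
  exists d e', [/\ 0 < d, 0 < e' <= 1 & forall th w,
    (forall i, `|th i - th0 i| < d) -> nrm (w - z0) < e' ->
    forall j, nrm ((curve_point m th0 z0) 0 j - (curve_point m th w) 0 j) < e].
Proof.
move=> nz0 e0; pose K : R := \sum_(i < n) (m i * 2 ^ m i)%:R.
have K0 : 0 <= K by apply: sumr_ge0.
have Ki i : (m i * 2 ^ m i)%:R <= K.
  by rewrite /K (bigD1 i) //= lerDl; apply: sumr_ge0.
have e20 : 0 < e / (2 * (K + 1)) by apply: divr_gt0; lra.
exists (e / 8), (Num.min 1 (e / (2 * (K + 1)))); split; first by lra.
  by rewrite lt_min ltr01 e20 ge_min lexx.
move=> th w hth; rewrite lt_min => /andP[w1 w2] j.
have wK : nrm (w - z0) * (K + 1) < e / 2.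
  move: w2; rewrite !ltr_pdivlMr; lra.
have dw := nrm_ge0 (w - z0).
have KK : 0 <= K * nrm (w - z0) by apply: mulr_ge0.
have [i ->|->] := unliftP ord0 j; last first.
  by rewrite !curve_point0 nrmBC; lra.
rewrite !curve_pointS.
have -> : expi (th0 i) * z0 ^+ m i - expi (th i) * w ^+ m i =
  (expi (th0 i) - expi (th i)) * z0 ^+ m i - expi (th i) * (w ^+ m i - z0 ^+ m i).
  by ring.
apply: le_lt_trans (nrmB _ _) _; rewrite !nrmM nrmX nz0 expr1n mulr1 nrm_expi mul1r.
have nw : nrm w <= 2 by have := nrmD (w - z0) z0; rewrite subrK; lra.
have h1 := nrm_exprB_le (m i) nw (_ : nrm z0 <= 2).
have {}h1 := h1 ltac:(by rewrite nz0; lra).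
have h2 : nrm (expi (th0 i) - expi (th i)) <= 2 * (e / 8).
  apply: le_trans (expi_lip _ _) _; rewrite distrC; have := hth i; lra.
have h3 : (m i * 2 ^ m i)%:R * nrm (w - z0) <= K * nrm (w - z0).
  exact: ler_wpM2r.
lra.
Qed.

Hypothesis hT : @torus R n.+1 `<=` boundary (@convergence_domain R n.+1 a).

Definition extends_at th := exists (z0 : C) (U : set 'rV[R[i]]_n.+1)
  (F : 'rV[R[i]]_n.+1 -> C),
  [/\ `|z0| = 1, open U, U (curve_point m th z0), holomorphic_on U F &
    forall z : 'rV[R[i]]_n.+1, (@convergence_domain R n.+1 a `&` U) z -> F z = pssum a z].

(** The extension is given at one phase vector, but its domain is open, so [z0], the radius [e] and
    the bound [M] serve all nearby phases. *)
Lemma local_extension th0 : extends_at th0 ->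
  exists (z0 : C) (e M d : R), [/\ nrm z0 = 1, 0 < e <= 1, 0 < d &
    forall th, (forall i, `|th i - th0 i| < d) -> exists G : C -> C,
      [/\ forall z, nrm (z - z0) < e -> cdiff G z,
          forall z, nrm (z - z0) < e -> nrm (G z) <= M &
          forall w, nrm w < 1 -> G w = pssum a (curve_point m th w)]].
Proof.
move=> [z0 [U [F [nz0 oU Up hF FE]]]].
have {}nz0 : nrm z0 = 1.
  by move: nz0; rewrite normC_nrm => /(congr1 (@complex.Re R)).
pose p := curve_point m th0 z0.
have /nbhs_rvP[e1 e10 h1] : nbhs p U by exact: open_nbhs_nbhs.
have [e2 e20 h2] := continuous_rvE (differentiable_continuous (hF _ Up)) ltr01.
have e30 : 0 < Num.min e1 e2 by rewrite lt_min e10.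
have [d [e [d0 e01 hc]]] := curve_point_continuous th0 nz0 e30.
exists z0, e, (nrm (F p) + 1), d; split => // th hth.
have inU w : nrm (w - z0) < e -> U (curve_point m th w).
  move=> wz; apply: h1 => j; have := hc _ _ hth wz j.
  by rewrite lt_min => /andP[].
(* The two pieces agree where they must: inside the unit disc the curve lies in the convergence
   domain, where [F] equals the sum. *)
exists (fun w => if nrm (w - z0) < e then F (curve_point m th w)
                 else pssum a (curve_point m th w)); split => [z zz|z zz|w w1].
- have dp : 0 < e - nrm (z - z0) by lra.
  apply: (@cdiff_local _ (fun w => F (curve_point m th w)) z _ dp).
    move=> w wz; have := nrm_tri z w z0 => k.
    by rewrite (_ : nrm (w - z0) < e) //; lra.
  apply: cdiff_comp_rv; first by apply: hF; exact: inU.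
  by move=> j; exact: cdiff_curve_point.
- rewrite zz; have := h2 (curve_point m th z) => k.
  have : nrm (F (curve_point m th z) - F p) < 1.
    by apply: k => j; have := hc _ _ hth zz j; rewrite lt_min => /andP[].
  have := nrmD (F (curve_point m th z) - F p) (F p); rewrite subrK; lra.
- case: ifP => // wz; apply: FE; split; last exact: inU.
  apply: (polydisc_convergence_domain hT) => j.
  by apply: (le_lt_trans _ w1); apply: (nrm_curve_point m_gt0); exact: ltW.
Qed.

Lemma locally_small th0 : extends_at th0 ->
  exists2 d : R, 0 < d & exists N1, forall th, (forall i, `|th i - th0 i| < d) ->
    forall N, (N1 <= N)%N -> nrm (\det (hankel (curve_coef a m th) N)) < 1.
Proof.
move=> /local_extension[z0 [e [M [d [nz0 e01 d0 hG]]]]].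
have [r r01 dec] := hankel_decay e01.
have [B aB] := torus_coef_bounded hT r01.
have [N1 hN1] := dec (Num.max M B).
exists d => //; exists N1 => th /hG[G [G1 G2 G3]].
apply: (hN1 z0 G) => // [k|z [zr|zz]].
- apply: (circle_avg_curve m_gt0 k r01 aB nz0) => w wr.
  by apply: G3; rewrite wr; lra.
- rewrite G3; last by rewrite zr; lra.
  rewrite le_max; apply/orP; right.
  apply: (@nrm_sum_le _ _ _ (fun k => `|a k|%:~R * r ^+ mdeg k) B) => // k.
  apply: nrm_psterm_le; first by lra.
  by move=> j; rewrite -zr; apply: (nrm_curve_point m_gt0); rewrite zr; lra.
- by rewrite le_max G2.
Qed.

Lemma uniformly_small : (forall th, extends_at th) ->
  exists N1, forall th, (forall i, 0 <= th i <= 2 * pi) ->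
    forall N, (N1 <= N)%N -> nrm (\det (hankel (curve_coef a m th) N)) < 1.
Proof.
move=> ext; pose K := [set v : 'rV[R]_n | forall i, `[0, 2 * pi]%classic (v ord0 i)].
have cK : compact K by apply: (@rV_compact R n (fun=> `[0, 2 * pi]%classic)) => i; exact: segment_compact.
have /compact_near_coveringP nc := cK.
pose P N (v : 'rV[R]_n) :=
  nrm (\det (hankel (curve_coef a m (fun i => v ord0 i)) N)) < 1.
(* Compactness is applied with [N] tending to infinity, so one threshold serves the whole cube. *)
have loc (v : 'rV[R]_n) : K v -> \forall v' \near v & N \near \oo, P N v'.
  move=> _; have [d d0 [N1 h]] := locally_small (ext (fun i => v ord0 i)).
  exists ([set v' : 'rV[R]_n | forall i, `|v' ord0 i - v ord0 i| < d], [set N | (N1 <= N)%N]).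
    split => /=; last by exists N1.
    apply/nbhs_ballP; exists d => //= v' [_ hv'] i; have := hv' ord0 i.
    by rewrite /ball /= distrC.
  by move=> [v' N] /= [hv' hN]; apply: h.
have [N1 _ hN1] := nc nat \oo P _ loc.
exists N1 => th hth N hN.
have := hN1 N hN (\row_i th i); rewrite /P.
have -> : (fun i => (\row_i0 th i0) ord0 i) = th by apply/funext => i; rewrite mxE.
apply => i; rewrite /= mxE in_itv /=; exact: hth.
Qed.

End Extension.

(** * From small Hankel determinants to rationality *)

Section TorusEvaluation.
Variables (R : realType) (n : nat).
Local Notation C := R[i].
Implicit Types (th : 'I_n -> R) (P : mpoly n int) (d : multinom n).

Definition torus_eval th : mpoly n int -> C :=
  mmap (intr : int -> C) (fun i => expi (th i)).

(** As a ring morphism, evaluation commutes with [\det]: the numerical Hankel determinants are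
    values of a determinant over Z[t]. *)
HB.instance Definition _ th := GRing.RMorphism.copy (torus_eval th)
  (mmap (intr : int -> C) (fun i => expi (th i))).

Lemma torus_evalE th P : torus_eval th P =
  \sum_(d <- msupp P) (mcoeff d P)%:~R * \prod_(i < n) expi (th i) ^+ d i.
Proof. by []. Qed.

(** Finite Fourier inversion: [msize P] exceeds every exponent, so the mean over the grid of [M]-th
    roots of unity is exactly the coefficient, an integer of modulus below 1. *)
Lemma torus_small_eq0 P :
  (forall th, (forall i, 0 <= th i <= 2 * pi) -> nrm (torus_eval th P) < 1) -> P = 0.
Proof.
move=> small; apply/mpolyP => d; rewrite mcoeff0; apply/eqP/negPn/negP => dP.
have dS : d \in msupp P by rewrite mcoeff_msupp.
pose M := msize P.
have bM e : e \in msupp P -> forall i, (e i < M)%N.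
  move=> eP i; apply: leq_ltn_trans (msize_mdeg_lt eP).
  by rewrite mdegE (bigD1 i) //= leq_addr.
have M0 : (0 < M)%N by apply: leq_ltn_trans (msize_mdeg_lt dS).
pose th (l : {ffun 'I_n -> 'I_M}) i : R := pi *+ 2 * ((l i)%:R / M%:R).
have thP l i : 0 <= th l i <= 2 * pi.
  have p0 := pi_ge0 R; have MR : 0 < M%:R :> R by rewrite ltr0n.
  have p2 : pi *+ 2 = 2 * pi :> R by rewrite mulr_natl.
  have q0 : 0 <= 2 * pi :> R by apply: mulr_ge0.
  rewrite /th p2; apply/andP; split.
    by apply: mulr_ge0 => //; apply: divr_ge0.
  rewrite -[leRHS]mulr1; apply: ler_wpM2l => //.
  by rewrite ler_pdivrMr // mul1r ler_nat ltnW.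
pose S := \sum_(l : {ffun 'I_n -> 'I_M}) torus_eval (th l) P *
   \prod_(i < n) (expi (th l i))^-1 ^+ d i.
have SE : S = (mcoeff d P)%:~R * (M ^ n)%:R.
  rewrite /S; under eq_bigr do rewrite torus_evalE mulr_suml.
  rewrite exchange_big /= (bigD1_seq d) ?msupp_uniq //= [X in _ + X]big1_seq ?addr0.
    under eq_bigr do rewrite -mulrA -big_split.
    rewrite -mulr_sumr; congr (_ * _).
    rewrite -(bigA_distr_bigA (fun (i : 'I_n) (l : 'I_M) =>
      expi (pi *+ 2 * (l%:R / M%:R)) ^+ d i * (expi (pi *+ 2 * (l%:R / M%:R)))^-1 ^+ d i)).
    under eq_bigr => i _ do rewrite root_of_unity_sum ?bM // eqxx.
    by rewrite prodr_const card_ord natrX.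
  move=> e /andP[ed eS]; under eq_bigr do rewrite -mulrA -big_split.
  rewrite -mulr_sumr.
  rewrite -(bigA_distr_bigA (fun (i : 'I_n) (l : 'I_M) =>
      expi (pi *+ 2 * (l%:R / M%:R)) ^+ e i * (expi (pi *+ 2 * (l%:R / M%:R)))^-1 ^+ d i)).
  under eq_bigr => i _ do rewrite root_of_unity_sum ?bM //.
  have [i ei] : exists i, e i != d i.
    apply/existsP; rewrite -[X in is_true X]negbK negb_exists; apply/negP => /forallP h.
    by move/negP: ed; apply; apply/eqP/mnmP => i; have := h i; rewrite negbK => /eqP.
  by rewrite (bigD1 i) //= (negPf ei) mul0r mulr0.
have nS : nrm S < (M ^ n)%:R.
  apply: le_lt_trans (nrm_sum _ _ _) _.
  have -> : (M ^ n)%:R = \sum_(l : {ffun 'I_n -> 'I_M}) (1 : R).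
    by rewrite sumr_const card_ffun !card_ord.
  have l0 : {ffun 'I_n -> 'I_M} by exact: [ffun=> Ordinal M0].
  have lt1 (l : {ffun 'I_n -> 'I_M}) : nrm (torus_eval (th l) P *
      \prod_(i < n) (expi (th l i))^-1 ^+ d i) < 1.
    rewrite nrmM nrm_prod big1 ?mulr1 ?small // => i _.
    by rewrite nrmX nrmV nrm_expi invr1 expr1n.
  rewrite (bigD1 l0) // [ltRHS](bigD1 l0) //=; apply: ltr_leD; first exact: lt1.
  by apply: ler_sum => l _; apply: ltW.
move: nS; rewrite SE nrmM nrm_int nrm_nat.
rewrite -[ltRHS]mul1r ltr_pM2r ?ltr0n ?expn_gt0 ?M0 //.
by rewrite ltrz1 => h; move: dP; rewrite -normr_gt0; move: `|_| h => x; lia.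
Qed.

End TorusEvaluation.

Section MultinomTail.
Variable n : nat.
Implicit Types (d : multinom n) (k : multinom n.+1).

Definition mnm_tail k : multinom n := Multinom [tuple k (lift ord0 i) | i < n].

Definition mnm_cons (c : nat) d : multinom n.+1 :=
  Multinom [tuple (if unlift ord0 i is Some j then d j else c) | i < n.+1].

Lemma mnm_tailE k i : mnm_tail k i = k (lift ord0 i).
Proof. by rewrite /mnm_tail multinomE tnth_mktuple. Qed.

Lemma mnm_cons0 c d : mnm_cons c d ord0 = c.
Proof. by rewrite /mnm_cons multinomE tnth_mktuple unlift_none. Qed.

Lemma mnm_consS c d i : mnm_cons c d (lift ord0 i) = d i.
Proof. by rewrite /mnm_cons multinomE tnth_mktuple liftK. Qed.

Lemma mnm_consK c d : mnm_tail (mnm_cons c d) = d.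
Proof. by apply/mnmP => i; rewrite mnm_tailE mnm_consS. Qed.

Lemma mnm_consE k : k = mnm_cons (k ord0) (mnm_tail k).
Proof.
apply/mnmP => i; have [j ->|->] := unliftP ord0 i.
  by rewrite mnm_consS mnm_tailE.
by rewrite mnm_cons0.
Qed.

Lemma mnm_cons_inj c c' d d' : mnm_cons c d = mnm_cons c' d' -> c = c' /\ d = d'.
Proof.
by move=> h; rewrite -(mnm_consK c d) h mnm_consK -(mnm_cons0 c d) h mnm_cons0.
Qed.

Variable m : 'I_n -> nat.

Definition mdot d := (\sum_(i < n) m i * d i)%N.

Lemma weight_cons c d : weight m (mnm_cons c d) = (c + mdot d)%N.
Proof.
rewrite /weight mnm_cons0; congr (_ + _)%N.
by apply: eq_bigr => i _; rewrite mnm_consS.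
Qed.

Lemma weightE k : weight m k = (k ord0 + mdot (mnm_tail k))%N.
Proof. by rewrite {1}[k]mnm_consE weight_cons. Qed.

Lemma mdot_sub d d' : (forall i, d i <= d' i)%N ->
  mdot d' = (mdot (mnm_sub d' d) + mdot d)%N.
Proof.
move=> dd; rewrite /mdot -big_split; apply: eq_bigr => i _ /=.
by rewrite mnmBE -mulnDr subnK.
Qed.

End MultinomTail.

Section MpolyProduct.
Variables (S : comNzRingType) (n : nat).
Implicit Types (p g : mpoly n S) (d k : multinom n).

Definition mnm_le d k := [forall j, d j <= k j]%N.

Lemma mcoeff_monomialM g d k :
  mcoeff k (mpolyX S d * g) = if mnm_le d k then mcoeff (mnm_sub k d) g else 0.
Proof.
rewrite mulrC; case: ifP => dk.
  rewrite -(mcoeffMX g d); congr mcoeff.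
  have /forallP h := dk.
  by apply/mnmP => i; rewrite mnmDE mnmBE subnKC.
apply/eqP; rewrite mcoeff_eq0 (perm_mem (msuppMX _ _)); apply/negP => /mapP[e _ ke].
move/negP: dk; apply; apply/forallP => j.
by rewrite ke mnmDE leq_addr.
Qed.

Lemma mcoeffM_supp p g k : mcoeff k (p * g) =
  \sum_(d <- msupp p | mnm_le d k) mcoeff d p * mcoeff (mnm_sub k d) g.
Proof.
rewrite {1}[p]mpolyE mulr_suml raddf_sum [RHS]big_mkcond; apply: eq_bigr => d _.
rewrite /= -scalerAl mcoeffZ mcoeff_monomialM.
by case: ifP; rewrite ?mulr0.
Qed.

End MpolyProduct.

Section CurvePoly.
Variables (R : realType) (n : nat) (a : powser n.+1) (m : 'I_n -> nat).
Hypothesis m_gt0 : forall i, (0 < m i)%N.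
Local Notation C := R[i].

(* With t_i in place of exp (i theta_i), the coefficient of w^k in
   f (w, t_1 w^(m_1), ..., t_n w^(m_n)). *)
Definition curve_poly (k : nat) : mpoly n int :=
  \sum_(j : bmultinom n.+1 k.+1 | weight m j == k) a j *: mpolyX int (mnm_tail j).

Lemma torus_eval_curve_poly (th : 'I_n -> R) k :
  torus_eval th (curve_poly k) = curve_coef a m th k.
Proof.
rewrite /curve_poly /curve_coef raddf_sum; apply: eq_bigr => j _.
rewrite /= /torus_eval mmapZ mmapX; congr (_ * _).
by apply: eq_bigr => i _; rewrite mnm_tailE.
Qed.

(** Nothing is lost along the curves: the weight k and the exponents of t determine the first
    exponent, so each coefficient of f occurs exactly once. *)
Lemma mcoeff_curve_poly k d : mcoeff d (curve_poly k) =
  if (mdot m d <= k)%N then a (mnm_cons (k - mdot m d) d) else 0.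
Proof.
rewrite /curve_poly raddf_sum /=.
under eq_bigr do rewrite mcoeffZ mcoeffX.
case: leqP => [dk|kd]; last first.
  rewrite big1 // => j /eqP jk; case: eqP => [jd|_]; last by rewrite mulr0.
  by move: jk; rewrite weightE jd; lia.
have wj : weight m (mnm_cons (k - mdot m d) d) = k by rewrite weight_cons subnK.
have hj : (mdeg (mnm_cons (k - mdot m d) d) < k.+1)%N.
  by rewrite ltnS -[leqRHS]wj mdeg_weight.
rewrite (bigD1 (BMultinom hj)) /=; last by rewrite wj.
rewrite mnm_consK eqxx mulr1 big1 ?addr0 // => j /andP[/eqP jk ne].
case: eqP => [jd|_]; last by rewrite mulr0.
case/negP: ne; rewrite bmeqP /= [X in X == _]mnm_consE jd.
have -> : (k - mdot m d = j ord0)%N by rewrite -[X in (X - _)%N]jk weightE jd addnK.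
by [].
Qed.

(** [Q] is the sum of the q_j w^(M+N0-j) after substituting w = z_0 and t_i = z_(i+1) / w^(m_i); the
    power w^M clears the denominators. The recurrence says that the product with f has no term of
    weight M + N0 or more. *)
Lemma represents_rational_of_recurrence N0 (q : nat -> mpoly n int) :
    q N0 != 0 ->
    (forall i, \sum_(j < N0.+1) q j * curve_poly (i + j) = 0) ->
  represents_rational R a.
Proof.
move=> qN0 rec.
pose M := (\sum_(j < N0.+1) \sum_(d <- msupp (q j)) mdot m d)%N.
have mM j d : (j <= N0)%N -> d \in msupp (q j) -> (mdot m d <= M)%N.
  move=> jN dS; rewrite /M (bigD1 (inord j)) //= inordK ?ltnS //.
  by rewrite (bigD1_seq d) ?msupp_uniq //= -addnA leq_addr.
pose e j d := mnm_cons (M + N0 - j - mdot m d) d.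
pose Q : mpoly n.+1 C := \sum_(j < N0.+1) \sum_(d <- msupp (q j))
  (mcoeff d (q j))%:~R *: mpolyX C (e j d).
pose T (k : multinom n.+1) : mpoly n.+1 C :=
  \sum_(j : bmultinom n.+1 (mdeg k).+1) (a j)%:~R *: mpolyX C j.
pose L k := \sum_(d <- msupp Q | mnm_le d k) mcoeff d Q * (a (mnm_sub k d))%:~R.
have LE k : L k = \sum_(j < N0.+1) \sum_(d <- msupp (q j) | mnm_le (e j d) k)
    (mcoeff d (q j))%:~R * (a (mnm_sub k (e j d)))%:~R.
  have TE d : mcoeff (mnm_sub k d) (T k) = (a (mnm_sub k d))%:~R.
    by rewrite /T (mcoeff_mpoly (fun j => (a j)%:~R)) // ltnS mdegB.
  have -> : L k = mcoeff k (Q * T k).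
    by rewrite mcoeffM_supp; apply: eq_bigr => d _; rewrite TE.
  rewrite /Q mulr_suml raddf_sum; apply: eq_bigr => j _.
  rewrite /= mulr_suml raddf_sum [RHS]big_mkcond; apply: eq_bigr => d _.
  rewrite /= -scalerAl mcoeffZ mcoeff_monomialM TE.
  by case: ifP; rewrite ?mulr0.
have L0 k : (M + N0 <= weight m k)%N -> L k = 0.
  move=> wk; pose i := (weight m k - (M + N0))%N.
  have := congr1 (mcoeff (mnm_tail k)) (rec i).
  rewrite raddf_sum mcoeff0 => /(congr1 (intr : int -> C)).
  rewrite /= rmorph_sum /= mulr0z => rk; rewrite LE -[RHS]rk; apply: eq_bigr => j _.
  rewrite /= mcoeffM_supp rmorph_sum.
  rewrite [LHS]big_mkcond [RHS]big_mkcond [LHS]big_seq [RHS]big_seq.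
  apply: eq_bigr => d dS.
  have dM : (mdot m d <= M)%N by apply: (mM j) => //; rewrite -ltnS.
  have jN : (j <= N0)%N by rewrite -ltnS.
  have leE : mnm_le (e j d) k = mnm_le d (mnm_tail k) &&
      (M + N0 - j - mdot m d <= k ord0)%N.
    apply/forallP/andP => [h|[/forallP h1 h2] l].
      split; last by have := h ord0; rewrite mnm_cons0.
      by apply/forallP => l; have := h (lift ord0 l); rewrite mnm_consS mnm_tailE.
    have [l' ->|->] := unliftP ord0 l; last by rewrite mnm_cons0.
    by rewrite mnm_consS -mnm_tailE.
  rewrite leE; case: (boolP (mnm_le d (mnm_tail k))) => //= /forallP dk.
  have md := mdot_sub m dk.
  have wkE : weight m k = (k ord0 + mdot m (mnm_tail k))%N by apply: weightE.
  rewrite mcoeff_curve_poly rmorphM.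
  have -> : (mdot m (mnm_sub (mnm_tail k) d) <= i + j)%N =
            (M + N0 - j - mdot m d <= k ord0)%N by rewrite /i; lia.
  case: leqP => hk; last by rewrite rmorph0 mulr0.
  congr (_ * (a _)%:~R); apply/mnmP => l.
  have [l' ->|->] := unliftP ord0 l.
    by rewrite mnm_consS !mnmBE mnm_consS mnm_tailE.
  by rewrite mnm_cons0 mnmBE mnm_cons0 /i; lia.
exists (\sum_(k : bmultinom n.+1 (M + N0)) L k *: mpolyX C k), Q; split; last first.
  move=> k; rewrite -/(L k); case: (ltnP (mdeg k) (M + N0)) => [lt|ge].
    by rewrite mcoeff_mpoly.
  rewrite L0; last by apply: leq_trans ge _; apply: mdeg_weight.
  rewrite raddf_sum big1 // => j _; rewrite /= mcoeffZ mcoeffX.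
  case: eqP => [jk|_]; last by rewrite mulr0.
  by have := bmdeg j; rewrite jk ltnNge ge.
(* [Q] is nonzero: its monomial [e N0 d0] cannot come from some j < N0, since equal tails would give
   a larger first exponent. *)
have [d0 d0S] : exists d, d \in msupp (q N0).
  case E : (msupp (q N0)) => [|d s]; last by exists d; rewrite mem_head.
  by move: qN0; rewrite -msupp_eq0 E.
apply/negP => /eqP Q0; have := congr1 (mcoeff (e N0 d0)) Q0.
rewrite mcoeff0 /Q raddf_sum (bigD1 ord_max) //= raddf_sum.
rewrite (bigD1_seq d0) ?msupp_uniq //= mcoeffZ mcoeffX eqxx mulr1.
rewrite big1 ?addr0 => [|d /negPf ne]; last first.
  rewrite mcoeffZ mcoeffX; case: eqP => [/mnm_cons_inj[_ dd]|_]; last by rewrite mulr0.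
  by rewrite dd eqxx in ne.
rewrite big1 ?addr0 => [/eqP|j jN].
  by rewrite intr_eq0 mcoeff_eq0 d0S.
rewrite raddf_sum /= big_seq big1 // => d dS; rewrite mcoeffZ mcoeffX.
case: eqP => [/mnm_cons_inj[dd1 dd]|_]; last by rewrite mulr0.
have jlt : (j < N0)%N.
  have : (j <= N0)%N by rewrite -ltnS.
  rewrite leq_eqVlt => /orP[/eqP jj|//]; case/negP: jN; apply/eqP/val_inj; exact: jj.
have := mM j d (ltnW jlt) dS; move: dd1; rewrite dd; lia.
Qed.

Lemma represents_rational_of_small N1 :
    (forall th, (forall i, 0 <= th i <= 2 * pi) -> forall N, (N1 <= N)%N ->
      nrm (\det (hankel (curve_coef (R := R) a m th) N)) < 1) ->
  represents_rational R a.
Proof.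
move=> small.
have [N0 [q [qN0 rec]]] : exists N0 (q : nat -> mpoly n int), q N0 != 0 /\
    forall i, \sum_(j < N0.+1) q j * curve_poly (i + j) = 0.
  apply: (@kronecker_criterion _ curve_poly N1) => N NN1.
  apply: (@torus_small_eq0 R) => th hth; have := small th hth N NN1.
  rewrite -det_map_mx; congr (nrm (\det _) < 1).
  by apply/matrixP => i j; rewrite !mxE /= torus_eval_curve_poly.
exact: represents_rational_of_recurrence qN0 rec.
Qed.

End CurvePoly.

(** * Extending a rational function across the torus *)

Section Digits.

Lemma digits_inj n (B : nat) (d d' : 'I_n -> nat) :
    (forall i, d i < B)%N -> (forall i, d' i < B)%N ->
    (\sum_(i < n) B ^ i * d i = \sum_(i < n) B ^ i * d' i)%N -> d =1 d'.
Proof.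
elim: n d d' => [|n IH] d d' hd hd'; first by move=> _ [].
rewrite !big_ord_recl /= !expn0 !mul1n.
have sE (c : 'I_n.+1 -> nat) : (\sum_(i < n) B ^ bump 0 i * c (lift ord0 i) =
    B * \sum_(i < n) B ^ i * c (lift ord0 i))%N.
  by rewrite big_distrr; apply: eq_bigr => i _; rewrite /= /bump add1n expnS mulnA.
rewrite !sE => e.
have e0 : d ord0 = d' ord0.
  have := congr1 (modn^~ B) e.
  by rewrite /= ![(B * _)%N]mulnC ![(_ + _ * B)%N]addnC !modnMDl !modn_small.
have B0 : (0 < B)%N by apply: leq_ltn_trans (hd ord0).
have := IH (d \o lift ord0) (d' \o lift ord0) (fun i => hd _) (fun i => hd' _).
move: e; rewrite e0 => /addnI /eqP; rewrite eqn_pmul2l // => /eqP e /(_ e) dd i.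
by have [j ->|->] := unliftP ord0 i; [exact: dd|].
Qed.

End Digits.

Section Forward.
Variables (R : realType).
Local Notation C := R[i].

(** If [p] vanished at all roots of unity of order [size p], orthogonality would make its leading
    coefficient 0. *)
Lemma nonroot_on_circle (p : {poly C}) : p != 0 ->
  exists2 z : C, nrm z = 1 & p.[z] != 0.
Proof.
move=> p0; apply: contrapT => h.
have all0 t : p.[expi t] = 0.
  apply/eqP/negPn/negP => hz; apply: h; exists (expi t) => //; exact: nrm_expi.
have s0 : (0 < size p)%N by rewrite size_poly_gt0.
have kM : ((size p).-1 < size p)%N by rewrite prednK.
have := erefl (\sum_(l < size p) p.[expi (pi *+ 2 * (l%:R / (size p)%:R) : R)] *
    (expi (pi *+ 2 * (l%:R / (size p)%:R)))^-1 ^+ (size p).-1).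
rewrite {1}big1 => [|l _]; last by rewrite all0 mul0r.
under eq_bigr do rewrite horner_coef mulr_suml.
rewrite exchange_big /=.
under eq_bigr => i _ do under eq_bigr do rewrite -mulrA.
under eq_bigr => i _ do rewrite -mulr_sumr root_of_unity_sum //.
rewrite (bigD1 (Ordinal kM)) //= eqxx big1 ?addr0 => [/esym/eqP|i ni]; last first.
  case: eqP => [ii|_]; last by rewrite mulr0.
  by case/negP: ni; apply/eqP/val_inj.
by rewrite mulf_eq0 pnatr_eq0 -lead_coefE lead_coef_eq0 (negPf p0) -leqn0 leqNgt s0.
Qed.

Variable n : nat.
Implicit Types (Q : mpoly n R[i]) (z : 'rV[R[i]]_n).

Definition rv_eval Q z : C := meval (fun j => z 0 j) Q.

Lemma rv_evalE Q z : rv_eval Q z =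
  \sum_(d <- msupp Q) mcoeff d Q * \prod_(j < n) z 0 j ^+ d j.
Proof. by rewrite /rv_eval mevalE. Qed.

Lemma differentiable_rv_eval Q z : differentiable (rv_eval Q) z.
Proof.
have -> : rv_eval Q = fun z => \sum_(d <- msupp Q) mcoeff d Q * \prod_(j < n) z 0 j ^+ d j.
  by apply/funext => w; exact: rv_evalE.
have dX j k : differentiable (fun w : 'rV[R[i]]_n => w 0 j ^+ k) z.
  elim: k => [|k IH].
    have -> : (fun w : 'rV[R[i]]_n => w 0 j ^+ 0) = cst 1.
      by apply/funext => w; rewrite expr0.
    exact: differentiable_cst.
  have -> : (fun w : 'rV[R[i]]_n => w 0 j ^+ k.+1) =
      (fun w : 'rV[R[i]]_n => w 0 j) * (fun w : 'rV[R[i]]_n => w 0 j ^+ k).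
    by apply/funext => w; rewrite exprS.
  apply: differentiableM => //; exact: differentiable_coord.
have dP d (s : seq 'I_n) : differentiable (fun w : 'rV[R[i]]_n => \prod_(j <- s) w 0 j ^+ d j) z.
  elim: s => [|j s IH].
    have -> : (fun w : 'rV[R[i]]_n => \prod_(j <- [::]) w 0 j ^+ d j) = cst 1.
      by apply/funext => w; rewrite big_nil.
    exact: differentiable_cst.
  have -> : (fun w : 'rV[R[i]]_n => \prod_(j <- j :: s) w 0 j ^+ d j) =
     (fun w : 'rV[R[i]]_n => w 0 j ^+ d j) * (fun w : 'rV[R[i]]_n => \prod_(j <- s) w 0 j ^+ d j).
    by apply/funext => w; rewrite big_cons.
  exact: differentiableM.
elim: (msupp Q) => [|d s IH].
  have -> : (fun w : 'rV[R[i]]_n => \sum_(d <- [::]) mcoeff d Q * \prod_(j < n) w 0 j ^+ d j) = cst 0.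
    by apply/funext => w; rewrite big_nil.
  exact: differentiable_cst.
have -> : (fun w : 'rV[R[i]]_n => \sum_(d <- d :: s) mcoeff d Q * \prod_(j < n) w 0 j ^+ d j) =
   cst (mcoeff d Q) * (fun w : 'rV[R[i]]_n => \prod_(j < n) w 0 j ^+ d j) +
   (fun w : 'rV[R[i]]_n => \sum_(d <- s) mcoeff d Q * \prod_(j < n) w 0 j ^+ d j).
  by apply/funext => w; rewrite big_cons.
have dc : differentiable (cst (mcoeff d Q) : 'rV[R[i]]_n -> C) z.
  exact: differentiable_cst.
exact: differentiableD (differentiableM dc (dP d _)) IH.
Qed.

Lemma open_rv_eval_neq0 Q : open [set z | rv_eval Q z != 0].
Proof.
rewrite openE => z /= Qz; apply/nbhs_rvP.
have c0 : 0 < nrm (rv_eval Q z) by rewrite nrm_gt0.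
have [d d0 hd] := continuous_rvE (differentiable_continuous (differentiable_rv_eval Q z)) c0.
exists d => // w /hd; rewrite /=; apply: contraTneq => ->.
by rewrite sub0r nrmN ltxx.
Qed.

(** P(z) is a combination of finitely many partial sums of f, one for each monomial of Q, and all of
    them can be taken close to f(z) at once. *)
Lemma rational_sum (a : powser n) (P Q : mpoly n R[i]) z :
    (forall k : multinom n, \sum_(d <- msupp Q | mnm_le d k)
       mcoeff d Q * (a (mnm_sub k d))%:~R = mcoeff k P) ->
    abs_convergent a z ->
  rv_eval Q z * pssum a z = rv_eval P z.
Proof.
move=> QP /abs_convergentP[B hB].
pose mon (d : multinom n) : C := \prod_(j < n) z 0 j ^+ d j.
have monD d k : mnm_le d k -> mon k = mon d * mon (mnm_sub k d).
  move=> /forallP dk; rewrite /mon -big_split; apply: eq_bigr => j _.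
  by rewrite /= mnmBE -exprD subnKC.
pose K := \sum_(d <- msupp Q) nrm (mcoeff d Q * mon d).
have K0 : 0 <= K by apply: sumr_ge0 => d _; apply: nrm_ge0.
apply/eqP; rewrite -subr_eq0 -nrm_eq0 eq_le nrm_ge0 andbT.
apply/ler_addgt0Pr => e e0; rewrite add0r.
have e10 : 0 < e / (K + 1) by apply: divr_gt0 => //; lra.
have [J0 hJ0] := summable_tail hB e10.
(* Containing the support of P and all translates of [J0] by exponents d of Q, this set ensures that
   each set [Jd d] shifted back by d still contains [J0]. *)
pose s := msupp P ++ [seq mnm_add j d | d <- msupp Q, j <- J0].
have [J memJ] : exists J : {fset multinom n}, J =i s.
  by exists [fset k in s]%fset => k; rewrite in_fset.
have Pz : rv_eval P z = \sum_(k <- J) mcoeff k P * mon k.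
  rewrite rv_evalE [RHS](bigID (mem (msupp P))) /= [X in _ = _ + X]big1 ?addr0; last first.
    by move=> k; rewrite -mcoeff_eq0 => /eqP ->; rewrite mul0r.
  rewrite -[RHS]big_filter; apply: perm_big; apply: uniq_perm.
  - exact: msupp_uniq.
  - by rewrite filter_uniq // fset_uniq.
  move=> k; rewrite mem_filter memJ mem_cat.
  by case: (k \in msupp P).
pose Jd (d : multinom n) : {fset multinom n} :=
  [fset mnm_sub k d | k in [fset k in J | mnm_le d k]]%fset.
have J0d d : d \in msupp Q -> fsubset J0 (Jd d).
  move=> dQ; apply/fsubsetP => j jJ0; apply/imfsetP; exists (mnm_add j d) => /=.
    rewrite !inE /=; apply/andP; split.
      have -> : mnm_add j d \in [eta mem_seq J] = (mnm_add j d \in J) by [].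
      rewrite memJ mem_cat; apply/orP; right.
      by apply/allpairsP; exists (d, j).
    by apply/forallP => i; rewrite mnmDE leq_addl.
  by rewrite addmK.
have sumJd d : \sum_(j <- Jd d) psterm a z j =
    \sum_(k <- J | mnm_le d k) psterm a z (mnm_sub k d).
  rewrite big_imfset /=; first by rewrite -big_fset_condE.
  move=> k1 k2; rewrite !inE /= => /andP[_ /forallP h1] /andP[_ /forallP h2] e12.
  apply/mnmP => i; have := congr1 (fun k : multinom n => k i) e12.
  by rewrite !mnmBE => e3; rewrite -(subnK (h1 i)) e3 subnK.
have sumJ : \sum_(k <- J) mcoeff k P * mon k =
    \sum_(d <- msupp Q) mcoeff d Q * mon d * \sum_(j <- Jd d) psterm a z j.
  under eq_bigr do rewrite -QP big_mkcond mulr_suml.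
  rewrite exchange_big /=; apply: eq_bigr => d _.
  rewrite sumJd mulr_sumr [RHS]big_mkcond; apply: eq_bigr => k _.
  case: ifP => [dk|_]; last by rewrite mul0r.
  by rewrite (monD _ _ dk) /psterm -/(mon _) mulrACA !mulrA.
rewrite Pz sumJ rv_evalE mulr_suml -sumrB.
apply: le_trans (nrm_sum _ _ _) _.
apply: (@le_trans _ _ (\sum_(d <- msupp Q) nrm (mcoeff d Q * mon d) * (e / (K + 1)))).
  rewrite big_seq [X in _ <= X]big_seq; apply: ler_sum => d dQ.
  rewrite -mulrBr nrmM; apply: ler_wpM2l; first exact: nrm_ge0.
  exact: (sum_approx (fun k => lexx _) hB hJ0 (J0d d dQ)).
rewrite -mulr_suml -/K mulrCA; apply: (ler_piMr (ltW e0)).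
rewrite ler_pdivrMr; lra.
Qed.

End Forward.

Section KroneckerSubstitution.
Variables (R : realType) (n : nat).
Implicit Types (Q : mpoly n.+1 R[i]) (th : 'I_n -> R).

(** The weight is the number whose digits in base [msize Q] are the exponents, all smaller than the
    base. *)
Lemma weight_inj Q d d' : d \in msupp Q -> d' \in msupp Q ->
  weight (fun i : 'I_n => msize Q ^ i.+1)%N d =
  weight (fun i : 'I_n => msize Q ^ i.+1)%N d' -> d = d'.
Proof.
have lt_msize c : c \in msupp Q -> forall i, (c i < msize Q)%N.
  move=> /msize_mdeg_lt h i; apply: leq_ltn_trans h.
  by rewrite mdegE (bigD1 i) //= leq_addr.
have wE c : weight (fun i : 'I_n => msize Q ^ i.+1)%N c =
    (\sum_(i < n.+1) msize Q ^ i * c i)%N.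
  by rewrite big_ord_recl expn0 mul1n.
move=> hd hd'; rewrite !wE => /(digits_inj (lt_msize _ hd) (lt_msize _ hd')) e.
exact/mnmP.
Qed.

(** The exponents depend on [Q] alone, as [m] must be fixed before the phases; the phases only
    multiply the coefficients by numbers of modulus 1, and distinct weights exclude cancellation. *)
Lemma nonroot_on_curve Q th : Q != 0 -> exists2 z0, nrm z0 = 1 &
  rv_eval Q (curve_point (fun i : 'I_n => msize Q ^ i.+1)%N th z0) != 0.
Proof.
move=> Q0; set m := (fun i : 'I_n => _).
pose p := \sum_(d <- msupp Q) (mcoeff d Q * phase th d) *: 'X^(weight m d).
have pE w : p.[w] = rv_eval Q (curve_point m th w).
  rewrite rv_evalE /p horner_sum; apply: eq_bigr => d _.
  by rewrite curve_monomial hornerZ hornerXn mulrA.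
suff /nonroot_on_circle[z0 z01 pz] : p != 0 by exists z0; rewrite // -pE.
have [d dQ] : exists d, d \in msupp Q.
  move: Q0; rewrite -msupp_eq0; case: (msupp Q) => // d s _.
  by exists d; rewrite mem_head.
apply/eqP => /(congr1 (fun q : {poly R[i]} => q`_(weight m d))).
rewrite coef0 coef_sum (bigD1_seq d dQ (msupp_uniq Q)) /=.
rewrite coefZ coefXn eqxx mulr1 big_seq_cond big1 ?addr0 => [/eqP|c /andP[cQ cd]].
  by rewrite mulf_eq0 mcoeff_eq0 dQ /= -nrm_eq0 nrm_phase oner_eq0.
rewrite coefZ coefXn; case: eqP => [/(weight_inj dQ cQ) dc|_]; last by rewrite mulr0.
by rewrite dc eqxx in cd.
Qed.

Lemma extends_of_rational (a : powser n.+1) : represents_rational R a ->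
  exists m : 'I_n -> nat, (forall i, (0 < m i)%N) /\
    forall th : 'I_n -> R, extends_at a m th.
Proof.
move=> [P [Q [Q0 QP]]]; exists (fun i : 'I_n => msize Q ^ i.+1)%N; split=> [i|th].
  by rewrite expn_gt0 lt0n msize_poly_eq0 Q0.
have [z0 z01 Qz0] := nonroot_on_curve th Q0.
exists z0, [set z | rv_eval Q z != 0], (fun z => rv_eval P z * (rv_eval Q z)^-1).
split.
- by rewrite normC_nrm z01.
- exact: open_rv_eval_neq0.
- exact: Qz0.
- move=> z Qz.
  have dV := differentiableV (differentiable_rv_eval Q z) Qz.
  exact: (differentiableM (differentiable_rv_eval P z) dV).
- move=> z [/interior_subset az Qz].
  by rewrite -(rational_sum QP az) mulrC mulKf.
Qed.

End KroneckerSubstitution.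

(* The number of variables is n.+1. *)
Theorem theorem2 (R : realType) (n : nat) (a : powser n.+1)
    (hT : @torus R n.+1 `<=` boundary (@convergence_domain R n.+1 a)) :
  represents_rational R a <->
  exists m : 'I_n -> nat, (forall k, (0 < m k)%N) /\
    forall theta : 'I_n -> R,
      exists (z0 : R[i]) (U : set 'rV[R[i]]_n.+1) (F : 'rV[R[i]]_n.+1 -> R[i]),
        [/\ `|z0| = 1,
            open U,
            U (curve_point m theta z0),
            holomorphic_on U F &
            forall z, (@convergence_domain R n.+1 a `&` U) z -> F z = pssum a z].
Proof.
split=> [|[m [m0 ext]]]; first exact: extends_of_rational.
have [N1 small] := uniformly_small m0 hT ext.
exact: (represents_rational_of_small m0 (N1 := N1) small).
Qed.
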